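(* The first cohomology group $\mathrm{H}^1(\mathrm{Vect}(S^1);\Psi\mathrm{D}(S^1))$ is four-dimensional and is generated by the classes of the 1-cocycles $$\theta_0(f\partial)=f,\qquad \theta_1(f\partial)=f',$$ $$\theta_2(f\partial)=\sum_{n=2}^\infty(-1)^{n-1}\frac{2(n-3)}{n}f^{(n)}\xi^{-n+1},\qquad \theta_3(f\partial)=\sum_{n=2}^\infty(-1)^{n}\frac{3(n-1)}{n+1}f^{(n+1)}\xi^{-n}.$$
   Context: $\mathrm{Vect}(S^1)$ is the Lie algebra of smooth vector fields $f\partial$, $\partial=d/dx$, on the circle, with $[f\partial,g\partial]=(fg'-f'g)\partial$. $\Psi\mathrm{D}(S^1)$ is the space of formal series $F=\sum_{k\in\mathbb{Z}}f_k(x)\xi^k$ with $f_k\in C^\infty(S^1)$ complex-valued and $f_k=0$ for all sufficiently large $k$, with the associative product $$F\circ G=\sum_{k\ge0}\frac1{k!}\,\partial_\xi^kF\;\partial_x^kG,$$ where products on the right are those of commuting variables, i.e. $(f\xi^k)(g\xi^\ell)=fg\,\xi^{k+\ell}$. It is a Lie algebra under $[F,G]=F\circ G-G\circ F$, and a $\mathrm{Vect}(S^1)$-module through the embedding $f\partial\mapsto f\xi$, i.e. $(f\partial)\cdot F=[f\xi,F]$. Cohomology is Lie algebra (Chevalley–Eilenberg) cohomology with continuous (Gelfand–Fuchs) cochains: a 1-cochain is a linear map $\gamma=\sum_k\gamma_k\xi^k$ with each $\gamma_k:\mathrm{Vect}(S^1)\to C^\infty(S^1)$ continuous for the $C^\infty$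 topologies and $\gamma_k=0$ for all sufficiently large $k$. It is a cocycle if $\gamma([X,Y])=X\cdot\gamma(Y)-Y\cdot\gamma(X)$, and a coboundary if $\gamma(X)=X\cdot F$ for some fixed $F\in\Psi\mathrm{D}(S^1)$. Dimension is over $\mathbb{C}$, the coefficient space being complex. *)

(* Defs.v *)
From HB Require Import structures.
From mathcomp Require Import all_boot all_order all_algebra.
From mathcomp Require Import zify.
From mathcomp Require Import complex generic_quotient ring_quotient.
From mathcomp Require Import all_classical all_reals all_analysis.

Set Implicit Arguments.
Unset Strict Implicit.
Unset Printing Implicit Defensive.

Import Order.TTheory GRing.Theory Num.Theory numFieldNormedType.Exports.

Local Open Scope ring_scope.
Local Open Scope classical_set_scope.

(* Smooth functions on S^1 = R / 2 pi Z, viewed as 2 pi-periodic functions of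
   the coordinate x : R. *)

Section RealSmooth.
Variable R : realType.
Implicit Types f g : R -> R.

Definition smooth f : Prop := forall n x, derivable (derive1n n f) x 1.

Definition periodic f : Prop := forall x, f (x + 2 * pi) = f x.

Definition circle_smooth : pred (R -> R) :=
  fun f => `[< smooth f /\ periodic f >].

Let smooth_upto n f := forall k, (k < n)%N -> forall x, derivable (derive1n k f) x 1.

Let smooth_upto0 f : smooth_upto 0 f.
Proof. by []. Qed.

Let smooth_uptoP f : smooth f <-> forall n, smooth_upto n f.
Proof. by split=> [sf n k _|sf n]; [exact: sf|exact: (sf n.+1)]. Qed.

Let smooth_uptoS n f :
  smooth_upto n.+1 f <-> (forall x, derivable f x 1) /\ smooth_upto n (derive1 f).
Proof.
split=> [sf|[sf0 sf] [|k] kn x].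
- split=> [|k kn x]; first exact: (sf 0%N).
  by rewrite -derive1Sn; exact: sf.
- exact: sf0.
- by rewrite derive1Sn; exact: sf.
Qed.

Let smooth_uptoW n f : smooth_upto n.+1 f -> smooth_upto n f.
Proof. by move=> sf k kn; apply: sf; rewrite ltnS ltnW. Qed.

Lemma derive1_lin (a : R) f g :
  (forall x, derivable f x 1) -> (forall x, derivable g x 1) ->
  derive1 (a *: f + g) = a *: derive1 f + derive1 g.
Proof.
move=> df dg; apply/funext => x.
rewrite derive1E (deriveD (f := a \*: f)); last exact: dg.
  by rewrite (deriveZ a (df x)) -!derive1E.
exact: derivableZ.
Qed.

Lemma derive1_mul f g :
  (forall x, derivable f x 1) -> (forall x, derivable g x 1) ->
  derive1 (f * g) = f * derive1 g + derive1 f * g.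
Proof.
move=> df dg; apply/funext => x.
rewrite derive1E deriveM // -!derive1E /GRing.add /GRing.mul /=.
by congr (_ + _); exact: mulrC.
Qed.

Let smooth_upto_lin n a f g :
  smooth_upto n f -> smooth_upto n g -> smooth_upto n (a *: f + g).
Proof.
elim: n f g => [|n IHn] f g; first by move=> _ _; exact: smooth_upto0.
move=> /smooth_uptoS[df sf] /smooth_uptoS[dg sg].
apply/smooth_uptoS; split=> [x|].
  by apply: derivableD; [exact: derivableZ|exact: dg].
by rewrite (derive1_lin a df dg); exact: IHn sf sg.
Qed.

Let smooth_upto_mul n f g :
  smooth_upto n f -> smooth_upto n g -> smooth_upto n (f * g).
Proof.
elim: n f g => [|n IHn] f g; first by move=> _ _; exact: smooth_upto0.
move=> sf sg; have [df sf'] := (smooth_uptoS n f).1 sf.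
have [dg sg'] := (smooth_uptoS n g).1 sg.
apply/smooth_uptoS; split=> [x|]; first by apply: derivableM; [exact: df|exact: dg].
rewrite (derive1_mul df dg) -[f * _]scale1r; apply: smooth_upto_lin.
- exact: IHn (smooth_uptoW sf) sg'.
- exact: IHn sf' (smooth_uptoW sg).
Qed.

Lemma circle_smoothP f : reflect (smooth f /\ periodic f) (f \in circle_smooth).
Proof. exact: asboolP. Qed.

Lemma circle_smooth_cst (c : R) : cst c \in circle_smooth.
Proof.
apply/circle_smoothP; split=> [n x|//].
suff [d ->] : exists d, derive1n n (cst c : R -> R) = cst d by exact: derivable_cst.
elim: n => [|n [d dE]]; first by exists c.
by exists 0; rewrite derive1nS dE; apply/funext => y; rewrite derive1_cst.
Qed.

Lemma circle_smooth_lin (a : R) f g : f \in circle_smooth ->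
  g \in circle_smooth -> a *: f + g \in circle_smooth.
Proof.
move=> /circle_smoothP[/smooth_uptoP sf pf] /circle_smoothP[/smooth_uptoP sg pg].
apply/circle_smoothP; split; first by apply/smooth_uptoP=> n; exact: smooth_upto_lin.
by move=> x; rewrite /GRing.add /GRing.scale /= -!/(GRing.add _ _) pf pg.
Qed.

Lemma circle_smooth_mul f g : f \in circle_smooth ->
  g \in circle_smooth -> f * g \in circle_smooth.
Proof.
move=> /circle_smoothP[/smooth_uptoP sf pf] /circle_smoothP[/smooth_uptoP sg pg].
apply/circle_smoothP; split; first by apply/smooth_uptoP=> n; exact: smooth_upto_mul.
by move=> x; rewrite /GRing.mul /= pf pg.
Qed.

Lemma circle_smooth_derive1 f : f \in circle_smooth -> (derive1 f : R -> R) \in circle_smooth.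
Proof.
move=> /circle_smoothP[sf pf]; apply/circle_smoothP; split=> [n x|x].
  by rewrite -derive1Sn; exact: sf.
have -> : derive1 f x = derive1 (f \o shift (2 * pi)) x.
  by congr (derive1 _ x); apply/funext => y /=; rewrite pf.
rewrite /derive1; do 2 f_equal; apply/funext => h /=.
by rewrite addrA.
Qed.

Fact circle_smooth_submod : submod_closed circle_smooth.
Proof.
split=> [|a f g]; first exact: circle_smooth_cst.
exact: circle_smooth_lin.
Qed.

HB.instance Definition _ :=
  GRing.isSubmodClosed.Build R (R -> R) circle_smooth circle_smooth_submod.

End RealSmooth.

Section VectorFields.
Variable R : realType.

(* The vector field f d/dx is represented by its real coefficient f. *)
Record Vect := MkVect { vcoef :> R -> R; _ : vcoef \in @circle_smooth R }.

HB.instance Definition _ := [isSub for vcoef].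
HB.instance Definition _ := [Choice of Vect by <:].
HB.instance Definition _ := [SubChoice_isSubLmodule of Vect by <:].

Fact Vect_bracket_subproof (X Y : Vect) :
  (X : R -> R) * derive1 Y - derive1 X * (Y : R -> R)
    \in @circle_smooth R.
Proof.
by apply: rpredB; apply: circle_smooth_mul;
  rewrite ?circle_smooth_derive1 ?(valP X) ?(valP Y).
Qed.

Definition Vect_bracket (X Y : Vect) : Vect := MkVect (Vect_bracket_subproof X Y).

(* The C^oo topology: uniform convergence of all derivatives. *)
Definition Vect_jet (X : Vect) : {ptws nat -> {uniform R -> R}} :=
  fun n => derive1n n X.

HB.instance Definition _ := Topological.copy Vect (initial_topology Vect_jet).

End VectorFields.

Section ComplexSmooth.
Variable R : realType.
Implicit Types h k : R -> R[i].

Definition circle_csmooth : pred (R -> R[i]) :=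
  fun h => (@complex.Re R \o h \in @circle_smooth R) &&
           (@complex.Im R \o h \in @circle_smooth R).

Lemma circle_csmoothP h :
  reflect (@complex.Re R \o h \in @circle_smooth R /\
           @complex.Im R \o h \in @circle_smooth R)
          (h \in circle_csmooth).
Proof. exact: andP. Qed.

Lemma circle_csmooth_cst (c : R[i]) : cst c \in circle_csmooth.
Proof. by apply/circle_csmoothP; split; exact: circle_smooth_cst. Qed.

Lemma circle_csmooth_mul h k : h \in circle_csmooth -> k \in circle_csmooth ->
  h * k \in circle_csmooth.
Proof.
move=> /circle_csmoothP[rh ih] /circle_csmoothP[rk ik].
apply/circle_csmoothP; split.
- have -> : @complex.Re R \o (h * k) = (@complex.Re R \o h) * (@complex.Re R \o k) -
              (@complex.Im R \o h) * (@complex.Im R \o k).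
    apply/funext => x; rewrite /GRing.mul /GRing.add /GRing.opp /=.
    by case: (h x) (k x) => [a b] [c d].
  by apply: rpredB; exact: circle_smooth_mul.
- have -> : @complex.Im R \o (h * k) = (@complex.Re R \o h) * (@complex.Im R \o k) +
              (@complex.Im R \o h) * (@complex.Re R \o k).
    apply/funext => x; rewrite /GRing.mul /GRing.add /GRing.opp /=.
    by case: (h x) (k x) => [a b] [c d].
  by apply: rpredD; exact: circle_smooth_mul.
Qed.

Lemma circle_csmooth_add h k : h \in circle_csmooth -> k \in circle_csmooth ->
  h + k \in circle_csmooth.
Proof.
move=> /circle_csmoothP[rh ih] /circle_csmoothP[rk ik].
apply/circle_csmoothP; split.
- have -> : @complex.Re R \o (h + k) = (@complex.Re R \o h) + (@complex.Re R \o k).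
    apply/funext => x; rewrite /GRing.add /=.
    by case: (h x) (k x) => [a b] [c d].
  exact: rpredD.
- have -> : @complex.Im R \o (h + k) = (@complex.Im R \o h) + (@complex.Im R \o k).
    apply/funext => x; rewrite /GRing.add /=.
    by case: (h x) (k x) => [a b] [c d].
  exact: rpredD.
Qed.

Fact circle_csmooth_submod : submod_closed circle_csmooth.
Proof.
split=> [|a h k sh sk]; first exact: circle_csmooth_cst.
apply: circle_csmooth_add => //.
have -> : a *: h = cst a * h by apply/funext.
by apply: circle_csmooth_mul => //; exact: circle_csmooth_cst.
Qed.

HB.instance Definition _ :=
  GRing.isSubmodClosed.Build R[i] (R -> R[i]) circle_csmooth circle_csmooth_submod.

Fact circle_csmooth_mulr : mulr_closed circle_csmooth.
Proof. by split; [exact: circle_csmooth_cst|exact: circle_csmooth_mul]. Qed.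

HB.instance Definition _ :=
  GRing.isMulClosed.Build (R -> R[i]) circle_csmooth circle_csmooth_mulr.

(* C^oo(S^1), complex-valued. *)
Record Csmooth := MkCsmooth { cfun :> R -> R[i]; _ : cfun \in circle_csmooth }.

HB.instance Definition _ := [isSub for cfun].
HB.instance Definition _ := [Choice of Csmooth by <:].
HB.instance Definition _ := [SubChoice_isSubLmodule of Csmooth by <:].
HB.instance Definition _ := [SubZmodule_isSubNzRing of Csmooth by <:].
HB.instance Definition _ := [SubNzRing_isSubComNzRing of Csmooth by <:].

Lemma Csmooth_scalerAl (a : R[i]) (h k : Csmooth) : a *: (h * k) = a *: h * k.
Proof. by apply/val_inj/funext => x; exact: mulrA. Qed.

Lemma Csmooth_scalerAr (a : R[i]) (h k : Csmooth) : a *: (h * k) = h * (a *: k).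
Proof. by rewrite mulrC Csmooth_scalerAl mulrC. Qed.

Fact cderiv_subproof (h : Csmooth) :
  (fun x => Complex (derive1 (@complex.Re R \o h) x) (derive1 (@complex.Im R \o h) x))
    \in circle_csmooth.
Proof.
have /circle_csmoothP[rh ih] := valP h.
by apply/circle_csmoothP; split; exact: circle_smooth_derive1.
Qed.

Definition cderiv (h : Csmooth) : Csmooth := MkCsmooth (cderiv_subproof h).

Fact cderiv_is_linear : linear cderiv.
Proof.
move=> a h k; apply/val_inj/funext => x /=.
have dR (l : Csmooth) y : derivable (@complex.Re R \o l) y 1.
  by have /circle_csmoothP[/circle_smoothP[sl _] _] := valP l; exact: (sl 0%N).
have dI (l : Csmooth) y : derivable (@complex.Im R \o l) y 1.
  by have /circle_csmoothP[_ /circle_smoothP[sl _]] := valP l; exact: (sl 0%N).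
pose re l : R -> R := @complex.Re R \o l; pose im l : R -> R := @complex.Im R \o l.
have -> : @complex.Re R \o cfun (a *: h + k) =
    complex.Re a *: re h + (- complex.Im a *: im h + re k).
  apply/funext => y; rewrite -[LHS]/(complex.Re (a * h y + k y)).
  rewrite -[RHS]/(complex.Re a * re h y + (- complex.Im a * im h y + re k y)).
  rewrite /re /im /=; case: a (h y) (k y) => [a b] [c d] [e f] /=.
  by rewrite addrA mulNr.
have -> : @complex.Im R \o cfun (a *: h + k) =
    complex.Re a *: im h + (complex.Im a *: re h + im k).
  apply/funext => y; rewrite -[LHS]/(complex.Im (a * h y + k y)).
  rewrite -[RHS]/(complex.Re a * im h y + (complex.Im a * re h y + im k y)).
  rewrite /re /im /=; case: a (h y) (k y) => [a b] [c d] [e f] /=.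
  by rewrite addrA.
have dS (b : R) (u v : R -> R) : (forall y, derivable u y 1) ->
    (forall y, derivable v y 1) -> forall y, derivable (b *: u + v) y 1.
  by move=> du dv y; apply: derivableD; [exact: derivableZ|exact: dv].
have dRh : forall y, derivable (re h) y 1 := dR h.
have dRk : forall y, derivable (re k) y 1 := dR k.
have dIh : forall y, derivable (im h) y 1 := dI h.
have dIk : forall y, derivable (im k) y 1 := dI k.
rewrite (derive1_lin _ dRh (dS _ _ _ dIh dRk)) (derive1_lin _ dIh dRk).
rewrite (derive1_lin _ dIh (dS _ _ _ dRh dIk)) (derive1_lin _ dRh dIk).
have cE (p q r s : R) : a * Complex p q + Complex r s =
    Complex (complex.Re a * p + (- complex.Im a * q + r))
            (complex.Re a * q + (complex.Im a * p + s)).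
  case: (a) => b c; rewrite -[LHS]/(Complex (b * p - c * q + r) (b * q + c * p + s)).
  by congr Complex; rewrite /= -addrA // mulNr.
exact/esym/cE.
Qed.

HB.instance Definition _ :=
  GRing.isLinear.Build R[i] Csmooth Csmooth *:%R cderiv cderiv_is_linear.

(* The C^oo topology: uniform convergence of all derivatives. *)
Definition Csmooth_jet (h : Csmooth) :
    {ptws nat -> {uniform R -> (R[i] : numFieldType)}} :=
  fun n => iter n cderiv h.

HB.instance Definition _ := Topological.copy Csmooth (initial_topology Csmooth_jet).

Fact Vect_Csmooth_subproof (X : Vect R) :
  (fun x => (X x)%:C)%C \in circle_csmooth.
Proof.
apply/circle_csmoothP; split; first exact: (valP X).
exact: circle_smooth_cst.
Qed.

Definition Vect_Csmooth (X : Vect R) : Csmooth :=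
  MkCsmooth (Vect_Csmooth_subproof X).

End ComplexSmooth.

Section PseudoDifferentialSymbols.
Variable R : realType.

(* F k is the coefficient of xi^k; the operations below are meant for series
   with F k = 0 for large k, for which all the sums have finite support. *)
Local Notation series := (int -> Csmooth R).
Implicit Types (F G H : series) (N M m : int).

Definition vanishes_above N F : Prop := forall k, N < k -> F k = 0.

Definition bounded_order : pred series :=
  fun F => `[< exists N, vanishes_above N F >].

(* d/dxi *)
Definition dxi F : series := fun k => (k + 1)%:~R *: F (k + 1).

(* d/dx *)
Definition dx F : series := fun k => cderiv (F k).

Definition commutative_mul F G : series :=
  fun m => \sum_(i \in [set: int]) F i * G (m - i).

Definition compose F G : series :=
  fun m => \sum_(k \in [set: nat])
    k`!%:R^-1 *: commutative_mul (iter k dxi F) (iter k dx G) m.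

Lemma vanishes_aboveW N M F :
  N <= M -> vanishes_above N F -> vanishes_above M F.
Proof. by move=> NM F0 k Mk; apply: F0; exact: le_lt_trans Mk. Qed.

Lemma vanishes_above_lin N a F G :
  vanishes_above N F -> vanishes_above N G -> vanishes_above N (a *: F + G).
Proof.
move=> F0 G0 k Nk; rewrite -[LHS]/(a *: F k + G k) F0// G0//.
by rewrite scaler0 addr0.
Qed.

Lemma bounded_orderP F :
  reflect (exists N, vanishes_above N F) (F \in bounded_order).
Proof. exact: asboolP. Qed.

Lemma bounded_order2 F G : F \in bounded_order -> G \in bounded_order ->
  exists N, vanishes_above N F /\ vanishes_above N G.
Proof.
move=> /bounded_orderP[N F0] /bounded_orderP[M G0]; exists (Num.max N M).
by split; [apply: vanishes_aboveW F0|apply: vanishes_aboveW G0];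
  rewrite le_max lexx ?orbT.
Qed.

Fact bounded_order_submod : submod_closed bounded_order.
Proof.
split=> [|a F G /bounded_order2 FG /FG[N [F0 G0]]].
  by apply/bounded_orderP; exists 0.
by apply/bounded_orderP; exists N; exact: vanishes_above_lin.
Qed.

HB.instance Definition _ :=
  GRing.isSubmodClosed.Build R[i] series bounded_order bounded_order_submod.

Lemma commutative_mulE N M n F G m :
  vanishes_above N F -> vanishes_above M G -> N + M - m < n%:Z ->
  commutative_mul F G m = \sum_(j < n) F (N - j%:Z) * G (m - (N - j%:Z)).
Proof.
move=> F0 G0 nlarge; rewrite /commutative_mul.
rewrite (fsbigE [seq N - j%:Z | j <- iota 0 n]).
- rewrite (eq_bigl xpredT) => [|i]; last by rewrite in_setT.
  by rewrite big_map -{1}[n]subn0 big_mkord.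
- by rewrite map_inj_uniq ?iota_uniq// => i j; lia.
- by [].
- move=> i _ ni.
  have [iN|/F0 ->] := leP i N; last by rewrite mul0r.
  have iE : i = N - `|N - i|%N%:Z.
    by rewrite gez0_abs ?subr_ge0// opprB addrC subrK.
  have jn : (n <= `|N - i|)%N.
    rewrite leqNgt; apply: contra ni => jn; apply/mapP; exists `|N - i|%N => //.
    by rewrite mem_iota.
  rewrite G0 ?mulr0//.
  by lia.
Qed.

Lemma commutative_mul0 N M F G : vanishes_above N F -> vanishes_above M G ->
  vanishes_above (N + M) (commutative_mul F G).
Proof.
move=> F0 G0 m NMm; rewrite (commutative_mulE (n := 0) F0 G0) ?big_ord0//.
by rewrite subr_lt0.
Qed.

Lemma commutative_mul_linl N M a F F' G : vanishes_above N F ->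
  vanishes_above N F' -> vanishes_above M G ->
  commutative_mul (a *: F + F') G =
    a *: commutative_mul F G + commutative_mul F' G.
Proof.
move=> F0 F'0 G0; apply/funext => m; set n := `|(N + M - m)%R|%N.+1.
have nP : N + M - m < n%:Z by rewrite /n; lia.
rewrite -[RHS]/(a *: commutative_mul F G m + commutative_mul F' G m).
have FF'0 := vanishes_above_lin a F0 F'0.
rewrite (commutative_mulE FF'0 G0 nP) (commutative_mulE F0 G0 nP).
rewrite (commutative_mulE F'0 G0 nP) scaler_sumr -big_split; apply: eq_bigr => j _ /=.
by rewrite Csmooth_scalerAl -mulrDl.
Qed.

Lemma commutative_mul_linr N M a F G G' : vanishes_above N F ->
  vanishes_above M G -> vanishes_above M G' ->
  commutative_mul F (a *: G + G') =
    a *: commutative_mul F G + commutative_mul F G'.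
Proof.
move=> F0 G0 G'0; apply/funext => m; set n := `|(N + M - m)%R|%N.+1.
have nP : N + M - m < n%:Z by rewrite /n; lia.
rewrite -[RHS]/(a *: commutative_mul F G m + commutative_mul F G' m).
have GG'0 := vanishes_above_lin a G0 G'0.
rewrite (commutative_mulE F0 GG'0 nP) (commutative_mulE F0 G0 nP).
rewrite (commutative_mulE F0 G'0 nP) scaler_sumr -big_split; apply: eq_bigr => j _ /=.
by rewrite Csmooth_scalerAr -mulrDr.
Qed.

Lemma iter_dxi0 N n F :
  vanishes_above N F -> vanishes_above (N - n%:Z) (iter n dxi F).
Proof.
elim: n => [|n IHn] F0 /=; first by rewrite subr0.
move=> k Nk; rewrite /dxi IHn// ?scaler0//.
by move: Nk; rewrite ltrBlDr intS addrA -ltrBlDr.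
Qed.

Lemma iter_dx0 N n F : vanishes_above N F -> vanishes_above N (iter n dx F).
Proof. by elim: n => [//|n IHn] F0 k Nk /=; rewrite /dx IHn// linear0. Qed.

Lemma iter_dxi_lin n a F G :
  iter n dxi (a *: F + G) = a *: iter n dxi F + iter n dxi G.
Proof.
elim: n => [//|n IHn] /=; rewrite IHn; apply/funext => k.
rewrite -[LHS]/((k + 1)%:~R *: (a *: iter n dxi F (k + 1) + iter n dxi G (k + 1))).
by rewrite scalerDr scalerA mulrC -scalerA.
Qed.

Lemma iter_dx_lin n a F G :
  iter n dx (a *: F + G) = a *: iter n dx F + iter n dx G.
Proof.
elim: n => [//|n IHn] /=; rewrite IHn; apply/funext => k.
exact: (linearP (@cderiv R)).
Qed.

Lemma composeE N M n F G m :
  vanishes_above N F -> vanishes_above M G -> N + M - m < n%:Z ->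
  compose F G m = \sum_(k < n)
    k`!%:R^-1 *: commutative_mul (iter k dxi F) (iter k dx G) m.
Proof.
move=> F0 G0 nlarge; rewrite /compose (fsbigE (iota 0 n)).
- rewrite (eq_bigl xpredT) => [|i]; last by rewrite in_setT.
  by rewrite -{1}[n]subn0 big_mkord.
- exact: iota_uniq.
- by [].
- move=> k _; rewrite mem_iota /= add0n -leqNgt => nk.
  rewrite (commutative_mul0 (@iter_dxi0 N k _ F0) (@iter_dx0 M k _ G0)) ?scaler0//.
  rewrite addrAC ltrBlDr -ltrBlDl; apply: lt_le_trans nlarge _.
  by rewrite lez_nat.
Qed.

Lemma compose0 N M F G : vanishes_above N F -> vanishes_above M G ->
  vanishes_above (N + M) (compose F G).
Proof.
move=> F0 G0 m NMm; rewrite (composeE (n := 0) F0 G0) ?big_ord0//.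
by rewrite subr_lt0.
Qed.

Lemma compose_linl N M a F F' G : vanishes_above N F ->
  vanishes_above N F' -> vanishes_above M G ->
  compose (a *: F + F') G = a *: compose F G + compose F' G.
Proof.
move=> F0 F'0 G0; apply/funext => m; set n := `|(N + M - m)%R|%N.+1.
have nP : N + M - m < n%:Z by rewrite /n; lia.
rewrite -[RHS]/(a *: compose F G m + compose F' G m).
have FF'0 := vanishes_above_lin a F0 F'0.
rewrite (composeE FF'0 G0 nP) (composeE F0 G0 nP) (composeE F'0 G0 nP).
rewrite scaler_sumr -big_split; apply: eq_bigr => k _ /=.
rewrite iter_dxi_lin (commutative_mul_linl _ (@iter_dxi0 N k _ F0) (@iter_dxi0 N k _ F'0) (@iter_dx0 M k _ G0)).
by rewrite scalerDr !scalerA [_ * a]mulrC.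
Qed.

Lemma compose_linr N M a F G G' : vanishes_above N F ->
  vanishes_above M G -> vanishes_above M G' ->
  compose F (a *: G + G') = a *: compose F G + compose F G'.
Proof.
move=> F0 G0 G'0; apply/funext => m; set n := `|(N + M - m)%R|%N.+1.
have nP : N + M - m < n%:Z by rewrite /n; lia.
rewrite -[RHS]/(a *: compose F G m + compose F G' m).
have GG'0 := vanishes_above_lin a G0 G'0.
rewrite (composeE F0 GG'0 nP) (composeE F0 G0 nP) (composeE F0 G'0 nP).
rewrite scaler_sumr -big_split; apply: eq_bigr => k _ /=.
rewrite iter_dx_lin (commutative_mul_linr _ (@iter_dxi0 N k _ F0) (@iter_dx0 M k _ G0) (@iter_dx0 M k _ G'0)).
by rewrite scalerDr !scalerA [_ * a]mulrC.
Qed.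

Record PsiD := MkPsiD { coeff :> series; _ : coeff \in bounded_order }.

HB.instance Definition _ := [isSub for coeff].
HB.instance Definition _ := [Choice of PsiD by <:].
HB.instance Definition _ := [SubChoice_isSubLmodule of PsiD by <:].

Fact PsiD_mul_subproof (P Q : PsiD) : compose P Q \in bounded_order.
Proof.
have /bounded_orderP[N P0] := valP P; have /bounded_orderP[M Q0] := valP Q.
by apply/bounded_orderP; exists (N + M); exact: compose0.
Qed.

Definition PsiD_mul (P Q : PsiD) : PsiD := MkPsiD (PsiD_mul_subproof P Q).

Definition PsiD_bracket (P Q : PsiD) : PsiD := PsiD_mul P Q - PsiD_mul Q P.

Fact PsiD_bracket_is_linear (P : PsiD) : linear (PsiD_bracket P).
Proof.
move=> a Q Q'; apply: val_inj.
have /bounded_orderP[N P0] := valP P.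
have [M [Q0 Q'0]] := bounded_order2 (valP Q) (valP Q').
rewrite -[LHS]/(compose P (a *: coeff Q + coeff Q') -
                compose (a *: coeff Q + coeff Q') P).
rewrite (compose_linl _ Q0 Q'0 P0) (compose_linr _ P0 Q0 Q'0).
rewrite -[RHS]/(a *: (compose P Q - compose Q P) + (compose P Q' - compose Q' P)).
by rewrite scalerBr opprD addrACA.
Qed.

(* h xi^k *)
Fact monomial_subproof (h : Csmooth R) (k : int) :
  (fun i : int => if i == k then h else 0) \in bounded_order.
Proof. by apply/bounded_orderP; exists k => i ki; rewrite gt_eqF. Qed.

Definition monomial (h : Csmooth R) (k : int) : PsiD :=
  MkPsiD (monomial_subproof h k).

Definition Vect_act (X : Vect R) (P : PsiD) : PsiD :=
  PsiD_bracket (monomial (Vect_Csmooth X) 1) P.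

Lemma Vect_act_is_linear X : linear (Vect_act X).
Proof. exact: PsiD_bracket_is_linear. Qed.

HB.instance Definition _ (X : Vect R) :=
  GRing.isLinear.Build R[i] PsiD PsiD *:%R (Vect_act X) (Vect_act_is_linear X).

End PseudoDifferentialSymbols.

(* The quotient of a module by a submodule. *)
Section ModuleQuotient.
Variables (K : pzRingType) (V : lmodType K) (S : pred V).
Variable submodS : submod_closed S.
Local Open Scope quotient_scope.

Definition submod_mem of submod_closed S : pred V := S.

HB.instance Definition _ := GRing.isSubmodClosed.Build K V (submod_mem submodS) submodS.

Definition lmod_quot :=
  Quotient.quot (GRing.ZmodClosed.clone V (submod_mem submodS) _).

HB.instance Definition _ := GRing.Zmodule.on lmod_quot.

Definition lmod_class (v : V) : lmod_quot := \pi_lmod_quot v.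

Lemma lmod_class_eq u v : lmod_class u = lmod_class v <-> u - v \in submod_mem submodS.
Proof. by rewrite Quotient.idealrBE; exact: (rwP eqP). Qed.

Lemma lmod_class_repr (x : lmod_quot) : lmod_class (repr x) = x.
Proof. exact: reprK. Qed.

Lemma lmod_classD u v : lmod_class (u + v) = lmod_class u + lmod_class v.
Proof. exact: Quotient.pi_add. Qed.

Definition lmod_quot_scale (a : K) (x : lmod_quot) : lmod_quot :=
  lmod_class (a *: repr x).

Lemma lmod_class_scale a v : lmod_quot_scale a (lmod_class v) = lmod_class (a *: v).
Proof.
apply/lmod_class_eq; rewrite -scalerBr; apply: rpredZ.
by apply/lmod_class_eq; rewrite lmod_class_repr.
Qed.

Let scaleA a b x :
  lmod_quot_scale a (lmod_quot_scale b x) = lmod_quot_scale (a * b) x.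
Proof. by rewrite -[x]lmod_class_repr !lmod_class_scale scalerA. Qed.

Let scale1 : left_id 1 lmod_quot_scale.
Proof. by move=> x; rewrite -[x]lmod_class_repr lmod_class_scale scale1r. Qed.

Let scaleDr : right_distributive lmod_quot_scale +%R.
Proof.
move=> a x y; rewrite -[x]lmod_class_repr -[y]lmod_class_repr.
by rewrite -lmod_classD !lmod_class_scale -lmod_classD scalerDr.
Qed.

Let scaleDl x : {morph lmod_quot_scale^~ x : a b / a + b}.
Proof.
move=> a b; rewrite -[x]lmod_class_repr.
by rewrite !lmod_class_scale -lmod_classD scalerDl.
Qed.

HB.instance Definition _ := GRing.Zmodule_isLmodule.Build K lmod_quot
  scaleA scale1 scaleDr scaleDl.

End ModuleQuotient.

Section Cohomology.
Variable R : realType.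
Implicit Types g : Vect R -> PsiD R.

(* Vect(S^1) is a real Lie algebra, so cochains are real-linear; they form a
   complex vector space through their values. *)
Definition cochain1 g : Prop :=
  [/\ forall (a : R) X Y, g (a *: X + Y) = (a%:C)%C *: g X + g Y,
      exists N : int, forall X, vanishes_above N (g X) &
      forall k : int, continuous (fun X => g X k : Csmooth R)].

Definition cocycle1 : pred (Vect R -> PsiD R) := fun g =>
  `[< cochain1 g /\
      forall X Y, g (Vect_bracket X Y) = Vect_act X (g Y) - Vect_act Y (g X) >].

Lemma Csmooth_continuousP (T : topologicalType) (u : T -> Csmooth R) :
  continuous u <-> forall n x (e : R[i]), 0 < e ->
    \forall y \near x, forall t,
      `|iter n (@cderiv R) (u x) t - iter n (@cderiv R) (u y) t| < e.
Proof.
split=> [uc n x e e0|uc].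
  have /pointwise_cvgP/(_ n) : {ptws, (@Csmooth_jet R \o u) @ x --> (@Csmooth_jet R \o u) x}.
    apply: continuous_comp; first exact: uc.
    exact: initial_continuous.
  move=> /(_ [set h | forall t, `|iter n (@cderiv R) (u x) t - h t| < e]).
  apply; apply/uniform_nbhs.
  exists [set p : (R[i] : numFieldType) * (R[i] : numFieldType) | `|p.1 - p.2| < e].
  split; last by move=> h /= hP t; exact: hP.
  by rewrite -entourage_ballE; exists e.
apply: continuous_comp_initial => x; apply/pointwise_cvgP => n A.
move=> /uniform_nbhs[E [entE EA]].
move: entE; rewrite -entourage_ballE => -[e /= e0 eE].
have := uc n x e e0; apply: filterS => y ye; apply: EA => t _.
by apply: eE; exact: ye.
Qed.

Lemma Csmooth_continuous_lin (T : topologicalType) (a : R[i]) (u v : T -> Csmooth R) :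
  continuous u -> continuous v -> continuous (fun x => a *: u x + v x).
Proof.
move=> /Csmooth_continuousP uc /Csmooth_continuousP vc.
apply/Csmooth_continuousP => n x e e0.
have linE y t : iter n (@cderiv R) (a *: u y + v y) t =
    a * iter n (@cderiv R) (u y) t + iter n (@cderiv R) (v y) t.
  have -> : iter n (@cderiv R) (a *: u y + v y) =
      a *: iter n (@cderiv R) (u y) + iter n (@cderiv R) (v y).
    by elim: n => //= m ->; rewrite linearP.
  by [].
have a1 : 0 < `|a| + 1 by rewrite ltr_wpDl.
have e2 : 0 < e / 2 by rewrite divr_gt0.
have := vc n x _ e2; have := uc n x _ (divr_gt0 e2 a1).
apply: filterS2 => y ye ye' t; rewrite !linE opprD addrACA -mulrBr.
apply: le_lt_trans (ler_normD _ _) _; rewrite [e]splitr.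
apply: ler_ltD (ye' t); rewrite normrM.
apply: le_trans (ler_wpM2l (normr_ge0 _) (ltW (ye t))) _.
by rewrite mulrCA ger_pMr// ler_pdivrMr// mul1r lerDl.
Qed.

Fact cocycle1_submod : submod_closed cocycle1.
Proof.
split=> [|a g h].
  apply/asboolP; split; last first.
    move=> X Y; rewrite -[RHS]/(Vect_act X 0 - Vect_act Y 0).
    by rewrite !linear0 addr0.
  split=> [b X Y||k]; first by rewrite scaler0 addr0.
    by exists 0.
  exact: cst_continuous.
move=> /asboolP[[gl [N g0] gc] gZ] /asboolP[[hl [M h0] hc] hZ].
apply/asboolP; split; last first.
  move=> X Y.
  rewrite -[LHS]/(a *: g (Vect_bracket X Y) + h (Vect_bracket X Y)) gZ hZ.
  rewrite -[RHS]/(Vect_act X (a *: g Y + h Y) - Vect_act Y (a *: g X + h X)).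
  rewrite (Vect_act_is_linear X a (g Y)) (Vect_act_is_linear Y a (g X)).
  move: (Vect_act X _) (Vect_act Y _) (Vect_act X _) (Vect_act Y _) => A B C D.
  by rewrite scalerBr opprD addrACA.
split=> [b X Y||k].
- rewrite -[LHS]/(a *: g (b *: X + Y) + h (b *: X + Y)) gl hl.
  rewrite -[RHS]/((b%:C)%C *: (a *: g X + h X) + (a *: g Y + h Y)).
  by rewrite !scalerDr !scalerA [a * _]mulrC addrACA.
- exists (Num.max N M) => X; apply: vanishes_above_lin.
    by apply: vanishes_aboveW (g0 X); rewrite le_max lexx.
  by apply: vanishes_aboveW (h0 X); rewrite le_max lexx orbT.
- exact: (@Csmooth_continuous_lin (Vect R) a _ _ (gc k) (hc k)).
Qed.

HB.instance Definition _ := GRing.isSubmodClosed.Build R[i]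
  (Vect R -> PsiD R) cocycle1 cocycle1_submod.

Record Z1 := MkZ1 { cocycle_fun :> Vect R -> PsiD R; _ : cocycle_fun \in cocycle1 }.

HB.instance Definition _ := [isSub for cocycle_fun].
HB.instance Definition _ := [Choice of Z1 by <:].
HB.instance Definition _ := [SubChoice_isSubLmodule of Z1 by <:].

Definition coboundary1 : pred Z1 :=
  fun z => `[< exists F : PsiD R, forall X, z X = Vect_act X F >].

Fact coboundary1_submod : submod_closed coboundary1.
Proof.
split=> [|a z w /asboolP[F zF] /asboolP[G wG]].
  by apply/asboolP; exists 0 => X; rewrite linear0.
apply/asboolP; exists (a *: F + G) => X.
by rewrite Vect_act_is_linear -zF -wG.
Qed.

Definition H1 := lmod_quot coboundary1_submod.
HB.instance Definition _ := GRing.Lmodule.on H1.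

Definition H1_class (z : Z1) : H1 := lmod_class coboundary1_submod z.

End Cohomology.

Section Theta.
Variable R : realType.
Implicit Types X : Vect R.

(* f^(n) *)
Definition nderiv n X : Csmooth R := iter n (@cderiv R) (Vect_Csmooth X).

Definition theta0 X : PsiD R := monomial (Vect_Csmooth X) 0.

Definition theta1 X : PsiD R := monomial (nderiv 1 X) 0.

(* The coefficient of xi^k is the term of index n = 1 - k >= 2. *)
Definition theta2_coeff X (k : int) : Csmooth R :=
  let n := `|1 - k|%N in
  if k <= -1 then ((-1) ^+ (n - 1) * (2 * (n%:R - 3) / n%:R)) *: nderiv n X else 0.

(* The coefficient of xi^k is the term of index n = - k >= 2. *)
Definition theta3_coeff X (k : int) : Csmooth R :=
  let n := `|k|%N in
  if k <= -2 then ((-1) ^+ n * (3 * (n%:R - 1) / (n%:R + 1))) *: nderiv n.+1 X else 0.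

Fact theta2_subproof X : theta2_coeff X \in @bounded_order R.
Proof.
by apply/bounded_orderP; exists (-1) => k k1; rewrite /theta2_coeff leNgt k1.
Qed.

Fact theta3_subproof X : theta3_coeff X \in @bounded_order R.
Proof.
by apply/bounded_orderP; exists (-2) => k k2; rewrite /theta3_coeff leNgt k2.
Qed.

Definition theta2 X : PsiD R := MkPsiD (theta2_subproof X).

Definition theta3 X : PsiD R := MkPsiD (theta3_subproof X).

End Theta.

(* Main.v *)
(* Replace Vect(S^1) by its complexification, the smooth complex functions. The top
   coefficient of a cocycle of order N is a cocycle with values in the densities
   of weight l = -N, so everything reduces, order by order, to densities. There,
   modulo a coboundary, c(1) is constant and c(exp(inx)) = k_n exp(inx), and the
   cocycle identity becomes a recursion on the k_n, solved only by coboundaries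
   and by f, f' (l = 0), f'' (l = 1), f''' (l = 2): the leading terms of
   theta_0, ..., theta_3. A cocycle that vanishes on all exp(inx) is zero; this
   follows from the cocycle identity and the uniqueness of Fourier coefficients.
   Below order -2 only coboundaries remain, and the successive corrections
   assemble into one formal series. *)
From HB Require Import structures.
Require Import Defs.
From mathcomp Require Import all_boot all_order all_algebra.
From mathcomp Require Import ring lra zify.
From mathcomp Require Import complex all_classical all_reals all_analysis.

Set Implicit Arguments.
Unset Strict Implicit.
Unset Printing Implicit Defensive.

Import Order.TTheory GRing.Theory Num.Theory numFieldNormedType.Exports.

Local Open Scope ring_scope.

(** * Primitives *)

(** The natural test fields exp(inx) are not real, which is why the algebra is complexified. On the
    circle a smooth function is a derivative exactly when its mean vanishes, so being a derivative
    ([is_exact]) replaces the vanishing of an integral, and exactness of exp(inx) h the vanishing of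
    a Fourier coefficient; such statements are refuted by Rolle's theorem.

    The descent in the order meets no obstruction: each nontrivial density class is the leading term
    of a genuine symbol-valued cocycle, so subtracting a coboundary and a multiple of that cocycle
    always lowers the order. The special weights come from factors that vanish there: a constant
    density t has a coboundary with eigenvalue l i n t on exp(inx), which is useless for l = 0, and
    the recursion on the k_n fails to determine k_(-1) for l = 1 and k_2 for l = 2. *)

Section RealPrimitive.
Variable R : realType.
Implicit Types f P : R -> R.

(** The integral over [a, x] is a primitive only to the right of a, and no single base point serves
    all of R. So the base point moves with x: as long as a lies to the left of both x and 0, the
    difference I a x - I a 0 does not depend on a. *)
Lemma continuous_primitive f : continuous f ->
  exists P, forall x, is_derive x (1 : R) P (f x).
Proof.
move=> cf.
pose I (a x : R) := \int[lebesgue_measure]_(t in [set` `[a, x]]) f t.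
have int_f (a b : R) : lebesgue_measure.-integrable [set` `[a, b]] (EFin \o f).
  apply: continuous_compact_integrable; first exact: segment_compact.
  exact: continuous_subspaceT.
have I_split a b x : a <= b -> b <= x -> I a x = I a b + I b x.
  move=> ab bx; apply/eqP; rewrite addrC -subr_eq; apply/eqP.
  rewrite /I (Rintegral_itvB (int_f a x)) ?bnd_simp//.
  rewrite Rintegral_itv_obnd_cbnd//.
  apply: integrableS (int_f b x) => //.
  by apply: subset_itvr; rewrite bnd_simp.
pose a (x : R) := - `|x| - 1.
exists (fun x => I (a x) x - I (a x) 0) => x.
(* For y within distance 1 of x, a y stays above b, so near x the primitive agrees with the one
   based at the fixed point b. *)
pose b := - `|x| - 2.
have dI : is_derive x (1 : R) (fun y => I b y - I b 0) (f x).
  rewrite -[f x]subr0; apply: is_deriveB.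
  have bx : b < x by rewrite /b; have := ler_norm (- x); rewrite normrN; lra.
  have x1 : x < x + 1 by rewrite ltrDl.
  have [dI <-] := continuous_FTC1_closed x1 (int_f b (x + 1)) bx (cf x).
  by rewrite derive1E; exact/derivableP.
apply: near_eq_is_derive dI.
near=> y.
have xy : `|y| < `|x| + 1.
  have : `|x - y| < 1 by near: y; apply: (@cvgr_dist_lt _ _ _ (nbhs x) _ id x (@cvg_id _ _)) => //.
  by have := ler_distD x y 0; rewrite !subr0 distrC; lra.
have ay : a y <= y by rewrite /a; have := ler_norm (- y); rewrite normrN; lra.
have a0 : a y <= 0 by rewrite /a; have := normr_ge0 y; lra.
have ba : b <= a y by rewrite /a /b; lra.
rewrite [LHS]/(I b y - I b 0) (I_split b (a y) y) // (I_split b (a y) 0) //.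
have addKB (p q r : R) : p + q - (p + r) = q - r by ring.
exact: addKB.
Unshelve. all: by end_near. Qed.

Lemma smooth_primitive f P : smooth f ->
  (forall x, is_derive x (1 : R) P (f x)) -> smooth P.
Proof.
move=> sf dP [|n] x; first by have := dP x => -[].
have -> : derive1n n.+1 P = derive1n n f; last exact: sf.
by rewrite derive1Sn; congr derive1n; apply/funext => y; rewrite derive1E; have [_ ->] := dP y.
Qed.

Lemma smooth_is_derive f x : smooth f -> is_derive x (1 : R) f (derive1 f x).
Proof. by move=> sf; rewrite derive1E; apply/derivableP; exact: (sf 0%N). Qed.

Lemma smooth_continuous f : smooth f -> continuous f.
Proof.
move=> sf x; apply: differentiable_continuous.
by apply/derivable1_diffP; exact: (sf 0%N).
Qed.

(** The constant m is the mean of f over a period; removing it is exactly what makes a primitive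
    periodic. *)
Lemma circle_smooth_primitive f : f \in @circle_smooth R ->
  exists m, exists2 P, P \in @circle_smooth R & forall x, f x = m + derive1 P x.
Proof.
move=> /circle_smoothP[sf pf].
have [P dP] := continuous_primitive (smooth_continuous sf).
pose m := (P (2 * pi) - P 0) / (2 * pi); pose Q x := P x - m * x.
have dQ x : is_derive x (1 : R) Q (f x - m).
  have := is_deriveB (dP x) (is_deriveZ m (is_derive_id x (1 : R))).
  by rewrite [m *: _]mulr1.
exists m, Q; last by move=> x; rewrite derive1E; have [_ ->] := dQ x; rewrite addrC subrK.
apply/circle_smoothP; split.
  apply: smooth_primitive dQ.
  suff /circle_smoothP[] : (f - cst m : R -> R) \in @circle_smooth R by [].
  by apply: rpredB; [exact/circle_smoothP|exact: circle_smooth_cst].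
move=> x; apply/eqP; rewrite -subr_eq0; apply/eqP.
have -> : Q (x + 2 * pi) - Q x = Q (0 + 2 * pi) - Q 0.
  apply: (@is_derive_0_is_cst R (fun x => Q (x + 2 * pi) - Q x)) => y.
  rewrite -[0](subrr (f y - m)) -{1}(pf y); apply: is_deriveB.
  rewrite -[f _ - m]mulr1; apply: (@is_derive1_comp _ Q).

  by have := is_deriveD (is_derive_id y (1 : R)) (is_derive_cst (2 * pi : R) y (1 : R)); rewrite addr0.
have : 2 * pi != 0 :> R by rewrite mulf_neq0 ?pnatr_eq0// lt0r_neq0// pi_gt0.
by rewrite /Q add0r /m; move: (2 * pi) => p p0; field.
Qed.

End RealPrimitive.

(** * The differential algebra of smooth functions on the circle *)

Section CsmoothAlgebra.
Variable R : realType.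
Local Notation A := (Csmooth R).
Local Notation D := (@cderiv R).
Implicit Types (h k P : A) (c : R[i]).

HB.instance Definition _ :=
  GRing.Lmodule_isLalgebra.Build R[i] (Csmooth R) (@Csmooth_scalerAl R).
HB.instance Definition _ :=
  GRing.Lalgebra_isComAlgebra.Build R[i] (Csmooth R).

Lemma Csmooth_eqP h k : (forall x, h x = k x) -> h = k.
Proof. by move=> hk; apply/val_inj/funext. Qed.

Lemma CsmoothDE h k x : (h + k) x = h x + k x. Proof. by []. Qed.

Lemma CsmoothBE h k x : (h - k) x = h x - k x. Proof. by []. Qed.

Lemma CsmoothME h k x : (h * k) x = h x * k x. Proof. by []. Qed.

Lemma CsmoothZE c h x : (c *: h) x = c * h x. Proof. by []. Qed.

Lemma Csmooth_smooth_Re h : smooth (fun x => complex.Re (h x)).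
Proof. by have /circle_csmoothP[/circle_smoothP[] ] := valP h. Qed.

Lemma Csmooth_smooth_Im h : smooth (fun x => complex.Im (h x)).
Proof. by have /circle_csmoothP[_ /circle_smoothP[] ] := valP h. Qed.

Lemma Csmooth_periodic h x : h (x + 2 * pi) = h x.
Proof.
have /circle_csmoothP[/circle_smoothP[_ pr] /circle_smoothP[_ pi']] := valP h.
by have := pr x; have := pi' x; rewrite /=; case: (h x) (h _) => a b [a' b'] /= -> ->.
Qed.

Lemma cderivE h u v :
  (forall x, is_derive x (1 : R) (fun x => complex.Re (h x)) (u x)) ->
  (forall x, is_derive x (1 : R) (fun x => complex.Im (h x)) (v x)) ->
  forall x, D h x = Complex (u x) (v x).
Proof.
move=> du dv x; rewrite /cderiv /= !derive1E.
by have [_ ->] := du x; have [_ ->] := dv x.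
Qed.

Lemma cderivM h k : D (h * k) = D h * k + h * D k.
Proof.
apply: Csmooth_eqP => x.
pose rh x := complex.Re (h x); pose ih x := complex.Im (h x).
pose rk x := complex.Re (k x); pose ik x := complex.Im (k x).
have drh x := smooth_is_derive x (@Csmooth_smooth_Re h).
have dih x := smooth_is_derive x (@Csmooth_smooth_Im h).
have drk x := smooth_is_derive x (@Csmooth_smooth_Re k).
have dik x := smooth_is_derive x (@Csmooth_smooth_Im k).
pose u x := derive1 rh x * rk x + rh x * derive1 rk x
            - (derive1 ih x * ik x + ih x * derive1 ik x).
pose v x := derive1 rh x * ik x + rh x * derive1 ik x
            + (derive1 ih x * rk x + ih x * derive1 rk x).
have -> : D (h * k) x = Complex (u x) (v x).
  apply: cderivE => y.
    have := is_deriveB (is_deriveM (drh y) (drk y)) (is_deriveM (dih y) (dik y)).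
    have -> : (fun x => complex.Re ((h * k) x)) = rh * rk - ih * ik.
      apply/funext => z; rewrite -[LHS]/(complex.Re (h z * k z)).
      rewrite -[RHS]/(rh z * rk z - ih z * ik z) /rh /ih /rk /ik.
      by case: (h z) (k z) => a b [c d].
    by move/is_derive_eq; apply; rewrite /u /GRing.scale /=; ring.
  have := is_deriveD (is_deriveM (drh y) (dik y)) (is_deriveM (dih y) (drk y)).
  have -> : (fun x => complex.Im ((h * k) x)) = rh * ik + ih * rk.
    apply/funext => z; rewrite -[LHS]/(complex.Im (h z * k z)).
    rewrite -[RHS]/(rh z * ik z + ih z * rk z) /rh /ih /rk /ik.
    by case: (h z) (k z) => a b [c d].
  by move/is_derive_eq; apply; rewrite /v /GRing.scale /=; ring.
rewrite /u /v -[RHS]/(D h x * k x + h x * D k x) /cderiv /= /rh /ih /rk /ik.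
case: (h x) (k x) => a b [c d] /=.
by apply/eqP; rewrite eq_complex /=; apply/andP; split; apply/eqP; ring.
Qed.

Lemma cderivD h k : D (h + k) = D h + D k. Proof. exact: linearD. Qed.

Lemma cderivN h : D (- h) = - D h. Proof. exact: linearN. Qed.

Lemma cderivZ c h : D (c *: h) = c *: D h. Proof. exact: linearZ. Qed.

Lemma cderivX h n : D (h ^+ n.+1) = n.+1%:R * (h ^+ n * D h).
Proof.
elim: n => [|n IHn]; first by rewrite expr0 expr1 !mul1r.
rewrite exprS cderivM IHn -[n.+2]addn1 natrD exprS; ring.
Qed.

Lemma cderiv1 : D 1 = 0.
Proof.
have := cderivM 1 1; rewrite !mulr1 !mul1r => /eqP.
by rewrite -subr_eq subrr => /eqP <-.
Qed.

Lemma algE c x : (c%:A : A) x = c.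
Proof. exact: mulr1. Qed.

Lemma cderiv_alg c : D c%:A = 0.
Proof. by rewrite linearZ /= cderiv1 scaler0. Qed.

Lemma cderiv_eq0 h : D h = 0 -> exists c, h = c%:A.
Proof.
move=> dh; exists (h 0); apply: Csmooth_eqP => x; rewrite algE.
have dh0 y : D h y = 0 by rewrite dh.
apply/eqP; rewrite eq_complex; apply/andP; split; apply/eqP.
  apply: (@is_derive_0_is_cst R (fun x => complex.Re (h x))) => y.
  suff <- : derive1 (fun x => complex.Re (h x)) y = 0.
    exact: smooth_is_derive (@Csmooth_smooth_Re h).
  by have := dh0 y; case.
apply: (@is_derive_0_is_cst R (fun x => complex.Im (h x))) => y.
suff <- : derive1 (fun x => complex.Im (h x)) y = 0.
  exact: smooth_is_derive (@Csmooth_smooth_Im h).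
by have := dh0 y; case.
Qed.

(** Since P is again periodic, this encodes that h has integral zero over the circle. *)
Definition is_exact h := exists P, h = D P.

Lemma exactD h k : is_exact h -> is_exact k -> is_exact (h + k).
Proof. by move=> [P ->] [Q ->]; exists (P + Q); rewrite linearD. Qed.

Lemma exactZ c h : is_exact h -> is_exact (c *: h).
Proof. by move=> [P ->]; exists (c *: P); rewrite linearZ. Qed.

(** Rolle's theorem on one period: an exact function cannot have positive real part throughout an
    open period. *)
Lemma exact_Re_root h (a : R) : is_exact h ->
  exists2 x, a < x < a + 2 * pi & complex.Re (h x) = 0.
Proof.
move=> [P ->]; have sP := @Csmooth_smooth_Re P.
have ab : a < a + 2 * pi by rewrite ltrDl mulr_gt0// pi_gt0.
have [|||x xab [_ dx]] := @Rolle R (fun x => complex.Re (P x)) _ _ ab.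
- by move=> x _; exact: (sP 0%N).
- exact: continuous_subspaceT (smooth_continuous sP).
- by rewrite Csmooth_periodic.
- by exists x; [move: xab; rewrite in_itv|rewrite /cderiv /= derive1E].
Qed.

Lemma exact_alg c : is_exact c%:A -> c = 0.
Proof.
move=> ec; apply/eqP; rewrite eq_complex; apply/andP; split; apply/eqP.
  by have [x _] := exact_Re_root 0 ec; rewrite algE.
have [x _] := exact_Re_root 0 (exactZ (- 'i%C) ec).
by rewrite scalerA algE; case: (c) => u v /=; rewrite !oppr0 mul0r sub0r mulN1r opprK.
Qed.

Lemma mean_decomposition h : exists c P, h = c%:A + D P.
Proof.
have /circle_csmoothP[sr si] := valP h.
have [a [P sP hP]] := circle_smooth_primitive sr.
have [b [Q sQ hQ]] := circle_smooth_primitive si.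
have sPQ : (fun x => Complex (P x) (Q x)) \in @circle_csmooth R.
  by apply/circle_csmoothP.
exists (Complex a b), (MkCsmooth sPQ); apply: Csmooth_eqP => x.
rewrite -[RHS]/(((Complex a b)%:A : A) x + Complex (derive1 P x) (derive1 Q x)) algE.
have := hP x; have := hQ x; rewrite /=; case: (h x) => u v /= -> ->.
by [].
Qed.

End CsmoothAlgebra.

(** * Trigonometric polynomials *)

Section Exponentials.
Variable R : realType.
Local Notation A := (Csmooth R).
Local Notation D := (@cderiv R).
Implicit Types (h k P : A) (c : R[i]).

Lemma circle_smooth_trig (a b : R) :
  (fun x => a * cos x + b * sin x) \in @circle_smooth R.
Proof.
have dtrig (u v x : R) :
    is_derive x (1 : R) (fun x => u * cos x + v * sin x) (v * cos x + - u * sin x).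
  have := is_deriveD (is_deriveZ u (is_derive_cos x)) (is_deriveZ v (is_derive_sin x)).
  by move/is_derive_eq; apply; rewrite /GRing.scale /=; ring.
apply/circle_smoothP; split=> [n x|x]; last first.
  by rewrite mulr_natl sinD2pi cosD2pi.
suff [u [v ->]] : exists u v, derive1n n (fun x => a * cos x + b * sin x) =
    (fun x => u * cos x + v * sin x) by have [] := dtrig u v x.
elim: n => [|n [u [v IHn]]]; first by exists a, b.
exists v, (- u); rewrite derive1nS IHn; apply/funext => y.
by rewrite derive1E; have [_ ->] := dtrig u v y.
Qed.

Fact expi1_subproof (s : R) : (fun x => Complex (cos x) (s * sin x)) \in @circle_csmooth R.
Proof.
apply/circle_csmoothP; split.
- have -> : complex.Re (R:=R) \o (fun x => Complex (cos x) (s * sin x)) =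
    (fun x => 1 * cos x + 0 * sin x).
    by apply/funext => x /=; rewrite mul1r mul0r addr0.
  exact: circle_smooth_trig.
- have -> : complex.Im (R:=R) \o (fun x => Complex (cos x) (s * sin x)) =
    (fun x => 0 * cos x + s * sin x).
    by apply/funext => x /=; rewrite mul0r add0r.
  exact: circle_smooth_trig.
Qed.

(** Used with s = 1 and s = -1, where it is exp(ix) and exp(-ix). *)
Definition expi1 s : A := MkCsmooth (expi1_subproof s).

(* x |-> exp (i n x) *)
Definition expi (n : int) : A :=
  match n with Posz m => expi1 1 ^+ m | Negz m => expi1 (-1) ^+ m.+1 end.

Lemma expi1_mulN : expi1 1 * expi1 (-1) = 1.
Proof.
apply: Csmooth_eqP => x; rewrite -[LHS]/(Complex _ _ * Complex _ _) -[RHS]/(1 : R[i]).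
apply/eqP; rewrite eq_complex /=; apply/andP; split; apply/eqP; last by ring.
by rewrite mul1r mulN1r mulrN opprK -!expr2 cos2Dsin2.
Qed.

Lemma expiS n : expi (n + 1) = expi1 1 * expi n.
Proof.
case: n => [m|[|m]].
- have -> : Posz m + 1 = Posz m.+1 by lia.
  by rewrite /= exprS.
- by rewrite /= expr1 expi1_mulN.
- have -> : Negz m.+1 + 1 = Negz m by rewrite !NegzE; lia.
  by rewrite /= [in RHS]exprS mulrA expi1_mulN mul1r.
Qed.

Lemma expiN1 n : expi (n - 1) = expi1 (-1) * expi n.
Proof. by rewrite -{2}(subrK 1 n) expiS mulrA [_ * expi1 1]mulrC expi1_mulN mul1r. Qed.

Lemma expiD n m : expi (n + m) = expi n * expi m.
Proof.
elim/int_rect: n => [|n IHn|n IHn]; first by rewrite add0r mul1r.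
- have -> : n.+1%:Z + m = n%:Z + m + 1 by lia.
  have -> : n.+1%:Z = n%:Z + 1 by lia.
  by rewrite !expiS IHn mulrA.
- have -> : - n.+1%:Z + m = - n%:Z + m - 1 by lia.
  have -> : - n.+1%:Z = - n%:Z - 1 by lia.
  by rewrite !expiN1 IHn mulrA.
Qed.

Lemma expi_mulN n : expi n * expi (- n) = 1.
Proof. by rewrite -expiD subrr. Qed.

Lemma cderiv_expi1 s : s * s = 1 -> D (expi1 s) = ('i * s%:C)%C *: expi1 s.
Proof.
move=> ss; apply: Csmooth_eqP => x.
rewrite (@cderivE R (expi1 s) (fun x => - sin x) (fun x => s * cos x)).
rewrite -[RHS]/('i%C * s%:C%C * Complex _ _).
by apply/eqP; rewrite eq_complex /=; apply/andP; split; apply/eqP; ring: ss.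
Qed.

Lemma cderiv_expi n : D (expi n) = ('i%C * n%:~R) *: expi n.
Proof.
elim/int_rect: n => [|n IHn|n IHn]; first by rewrite mulr0 scale0r cderiv1.
- have -> : n.+1%:Z = n%:Z + 1 by lia.
  rewrite expiS cderivM IHn cderiv_expi1 ?mulr1// -scalerAl -scalerAr -scalerDl.
  by congr (_ *: _); rewrite intrD mulrDr mulr1 addrC.
- have -> : - n.+1%:Z = - n%:Z - 1 by lia.
  rewrite expiN1 cderivM IHn cderiv_expi1 ?mulrNN ?mulr1// -scalerAl -scalerAr -scalerDl.
  have -> : ((-1)%:C)%C = -1 :> R[i] by apply/eqP; rewrite eq_complex /= oppr0 !eqxx.
  by congr (_ *: _); rewrite intrD mulrDr mulrN1 addrC.
Qed.

Lemma expi1E (t : R) : (expi 1 : A) t = Complex (cos t) (sin t).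
Proof. by rewrite -[expi 1]/(expi1 1) /= mul1r. Qed.

Lemma expiN1E (t : R) : (expi (-1) : A) t = Complex (cos t) (- sin t).
Proof. by rewrite -[expi (-1)]/(expi1 (-1)) /= mulN1r. Qed.

(** The function y |-> cos(y - x), written in exponentials so that multiplying by it keeps products
    with all exp(imy) exact, as [exact_bump] requires. *)
Definition cos_at (x : R) : A :=
  (2^-1 * expi (-1) x) *: expi 1 + (2^-1 * expi 1 x) *: expi (-1).

Lemma cos_atE x y : cos_at x y = (cos (y - x))%:C%C.
Proof.
rewrite -[LHS]/(2^-1 * expi (-1) x * expi 1 y + 2^-1 * expi 1 x * expi (-1) y).
rewrite !expi1E !expiN1E cosB.
rewrite -!mulrA -mulrDr; apply: (mulfI (_ : 2 != 0 :> R[i])); first by rewrite pnatr_eq0.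
rewrite mulrA divff ?pnatr_eq0// mul1r -[2 * _]/((1 + 1) * _) mulrDl mul1r.
by apply/eqP; rewrite eq_complex /=; apply/andP; split; apply/eqP; ring.
Qed.

(* Up to exact terms 1 - cos_at x averages to 1/(n+2) against (1 + cos_at x)^(n+1),
   so these kernels concentrate at x. *)
Lemma cos_at_bump_exact x n :
  is_exact ((1 - n.+2%:R * (1 - cos_at x)) * (1 + cos_at x) ^+ n.+1).
Proof.
set c := cos_at x; pose s := D c.
pose a := (2^-1 * expi (-1) x)%:A * expi 1; pose b := (2^-1 * expi 1 x)%:A * expi (-1).
have cE : c = a + b by rewrite /c /cos_at /a /b !mulr_algl.
have da : D a = ('i%C)%:A * a.
  rewrite /a !mulr_algl cderivZ cderiv_expi !scalerA; congr (_ *: _).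
  by rewrite mulr1 mulrC.
have db : D b = - ('i%C)%:A * b.
  rewrite /b mulNr !mulr_algl cderivZ cderiv_expi !scalerA -scaleNr; congr (_ *: _).
  by rewrite rmorphN1 mulrN1 mulrN mulrC.
have sE : s = 'i%C%:A * (a - b) by rewrite /s cE cderivD da db; ring.
have ii : ('i%C)%:A * ('i%C)%:A = -1 :> A.
  by rewrite mulr_algl scalerA -expr2 sqr_i scaleN1r.
have ds : D s = - c.
  rewrite sE cE cderivM cderivD cderivN da db cderiv_alg; ring: ii.
have ab : 4 * (a * b) = 1.
  have -> : a * b = (2^-1 * expi (-1) x * (2^-1 * expi 1 x))%:A * (expi 1 * expi (-1)).
    by rewrite /a /b !mulr_algl -scalerAl -scalerAr scalerA.
  rewrite expi_mulN mulr1.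
  have e1 : expi (-1) x * expi 1 x = 1 :> R[i].
    by rewrite -[LHS]/((expi (-1) * expi 1) x) mulrC expi_mulN.
  rewrite mulrACA e1 mulr1 -invfM -natrM mulr_natl scalerMnl -mulr_natl.
  by rewrite divff ?scale1r// pnatr_eq0.
have sc : s ^+ 2 + c ^+ 2 = 1 by rewrite sE cE; ring: ii ab.
(* With s = c' and s' = -c, the derivative is c (1 + c)^(n+1) - (n+1) s^2 (1 + c)^n. Writing s^2 =
   (1 - c)(1 + c) turns it into (1 + c)^(n+1) (c - (n+1)(1 - c)), the required function. *)
exists (- (s * (1 + c) ^+ n.+1)).
rewrite cderivN cderivM ds cderivX cderivD cderiv1 -/s.
rewrite exprS -[n.+2]addn1 natrD; move: (_ ^+ n) => p; move: sc.
move: c s {cE sE ds} => c s sc.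
have {}sc : s * s = 1 - c * c by rewrite -sc; ring.
rewrite add0r; move: (n.+1%:R) => N.
transitivity ((1 + c) * p * (c - N * (1 - c))); first by ring.
transitivity (c * (1 + c) * p - N * p * (s * s)); last by ring.
by rewrite sc; ring.
Qed.

Lemma exprCsmoothE h n y : (h ^+ n) y = h y ^+ n.
Proof. by elim: n => // n IHn; rewrite !exprS -IHn. Qed.

Lemma exact_bump h x n : (forall m, is_exact (expi m * h)) ->
  is_exact ((1 + cos_at x) ^+ n * h).
Proof.
move=> eh; suff: forall m, is_exact (expi m * ((1 + cos_at x) ^+ n * h)).
  by move/(_ 0); rewrite mul1r.
elim: n => [|n IHn] m; first by rewrite mul1r.
rewrite exprS -mulrA; move: (_ ^+ n * h) IHn => k IHn.
rewrite mulrDl mul1r mulrDr; apply: exactD => //.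
rewrite /cos_at mulrDl mulrDr -!scalerAl -!scalerAr !mulrA -!expiD.
by apply: exactD; apply: exactZ.
Qed.

(* If Re h(x) > 0, subtracting from h (1 + cos_at x)^(n+1) a multiple of the exact
   function above leaves an exact function with positive real part on
   ]x - pi, x + pi[, against Rolle's theorem. *)
Lemma Fourier_uniqueness h : (forall n, is_exact (expi n * h)) -> h = 0.
Proof.
move=> eh; apply: Csmooth_eqP => x; apply/eqP; apply/negPn/negP => hx0.
(* The value of k at x is |h x|^2, so a nonzero h x becomes a positive real part. *)
pose k : A := (h x)^*%C *: h.
have ek n : is_exact (expi n * k) by rewrite -scalerAr; exact: exactZ.
pose r y := complex.Re (k y).
have rx0 : 0 < r x.
  rewrite /r -[k x]/((h x)^*%C * h x) mulrC.
  move: hx0; case: (h x) => a b; rewrite eq_complex negb_and /= => ab.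
  rewrite mulrN opprK -!expr2 lt_def addr_ge0 ?sqr_ge0// andbT paddr_eq0 ?sqr_ge0//.
  by rewrite !sqrf_eq0 negb_and.
pose g := r x / 2.
have g0 : 0 < g by rewrite divr_gt0.
have cr : continuous r := smooth_continuous (@Csmooth_smooth_Re R k).
have [d d0 rd] : exists2 d, 0 < d < pi & forall y, `|y - x| < d -> g < r y.
  have : \forall y \near x, g < r y.
    near=> y; have : `|r x - r y| < g by near: y; apply: (@cvgr_dist_lt _ _ _ (nbhs x) _ r (r x) (cr x)) => //.
    by rewrite ltr_norml /g => /andP[_]; lra.
  move=> /nbhs_ballP[e /= e0 eP]; exists (Num.min e (pi / 2)).
    by rewrite lt_min e0 divr_gt0 ?pi_gt0//= gt_min; have := @pi_gt0 R; lra.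
  by move=> y; rewrite lt_min distrC => /andP[ye _]; exact: eP.
have cos_mono (s t : R) : 0 <= s -> s <= t -> t <= pi -> cos t <= cos s.
  move=> s0 st tp; rewrite leNgt ltr_cos ?in_itv/= -?leNgt ?s0//; lra.
have [K rK] : exists K, forall y, x - pi <= y <= x + pi -> - K <= r y.
  have [||c _ rc] := @EVT_min R r (x - pi) (x + pi).
  - by have := @pi_gt0 R; lra.
  - exact: continuous_subspaceT.
  - by exists (- r c) => y; rewrite opprK => /rc; apply; rewrite in_itv.
have kap0 : 0 < 1 - cos d.
  by rewrite subr_gt0 -[ltRHS]cos0 ltr_cos ?in_itv/= ?lexx ?pi_ge0//; lra.
(* Farther than d from x, g (n+2) (1 - cos(y - x)) must exceed g + K in order to beat the lower
   bound -K of r; closer than d, r y > g is already enough. *)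
have [n nP] : exists n : nat, (g + K) / (g * (1 - cos d)) < n.+2%:R.
  pose z := (g + K) / (g * (1 - cos d)).
  exists (Num.truncn z); apply: lt_trans (truncnS_gt z) _.
  by rewrite ltr_nat.
have := exact_Re_root (x - pi) (exactD (exact_bump x n.+1 ek)
  (exactZ (- g%:C%C) (cos_at_bump_exact x n))).
move=> [y xy]; apply/eqP; rewrite gt_eqF//.
have xy' : `|y - x| < pi by rewrite ltr_norml; lra.
have c1 : 0 < 1 + cos (y - x).
  rewrite -ltrBlDl sub0r -cospi -(cos_norm (y - x)) ltr_cos ?in_itv/= ?lexx ?pi_ge0 ?normr_ge0//.
  exact: ltW.
have -> : complex.Re (((1 + cos_at x) ^+ n.+1 * k + (- g%:C%C) *:
   ((1 - n.+2%:R * (1 - cos_at x)) * (1 + cos_at x) ^+ n.+1)) y) =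
   (1 + cos (y - x)) ^+ n.+1 * (r y - g * (1 - n.+2%:R * (1 - cos (y - x)))).
  have c1E : (1 + cos_at x) y = (1 + cos (y - x))%:C%C.
    rewrite -[LHS]/(1 + cos_at x y) cos_atE.
    by apply/eqP; rewrite eq_complex /= addr0 !eqxx.
  have nE : (n.+2%:R : A) y = n.+2%:R%:C%C.
    by rewrite -scaler_nat algE rmorph_nat.
  rewrite CsmoothDE CsmoothZE !CsmoothME exprCsmoothE c1E CsmoothBE CsmoothME CsmoothBE.
  rewrite nE cos_atE -(rmorphXn (real_complex R)); move: (_ ^+ _) => q.
  rewrite /r; case: (k y) => u v /=; ring.
apply: mulr_gt0; first exact: exprn_gt0.
have [yd|yd] := ltP `|y - x| d.
  have := rd _ yd; have : 0 <= n.+2%:R * (1 - cos (y - x)).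
    by rewrite mulr_ge0// subr_ge0 cos_le1.
  nra.
have cd : 1 - cos d <= 1 - cos (y - x).
  by rewrite lerD2l lerN2 -(cos_norm (y - x)) cos_mono// ltW//; case/andP: d0.
have /rK ry : x - pi <= y <= x + pi by lra.
rewrite ltr_pdivrMr ?mulr_gt0// in nP.
have : n.+2%:R * (g * (1 - cos d)) <= n.+2%:R * (g * (1 - cos (y - x))).
  by rewrite ler_wpM2l// ler_wpM2l// ltW.
lra.
Unshelve. all: by end_near. Qed.

End Exponentials.

(** * Cocycles with values in tensor densities *)

Section DensityCocycles.
Variable R : realType.
Local Notation A := (Csmooth R).
Local Notation D := (@cderiv R).
Local Notation I := (in_alg A 'i%C).
Implicit Types (f g h : A) (c d : A -> A) (l : int).

Lemma scale_alg a f : a *: f = in_alg A a * f.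
Proof. by rewrite mulr_algl. Qed.

Lemma imagM : I * I = -1.
Proof. by rewrite -rmorphM -expr2 sqr_i rmorphN1. Qed.

Lemma cderiv_expiM n : D (expi R n) = I * n%:~R * expi R n.
Proof. by rewrite cderiv_expi scale_alg rmorphM rmorph_int. Qed.

(* The Lie derivative along f d/dx on densities of weight l. *)
Definition density_act l f h : A := f * D h + l%:~R * (D f * h).

Definition density_cocycle l c :=
  (forall a f g, c (a *: f + g) = a *: c f + c g) /\
  (forall f g, c (f * D g - D f * g) = density_act l f (c g) - density_act l g (c f)).

Section Linearity.
Variable c : A -> A.
Hypothesis cL : forall a f g, c (a *: f + g) = a *: c f + c g.

Lemma lin0 : c 0 = 0.
Proof. by have := cL (-1) 0 0; rewrite scaler0 addr0 scaleN1r addNr. Qed.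

Lemma linD f g : c (f + g) = c f + c g.
Proof. by have := cL 1 f g; rewrite !scale1r. Qed.

Lemma linZ a f : c (a *: f) = a *: c f.
Proof. by have := cL a f 0; rewrite lin0 !addr0. Qed.

Lemma linN f : c (- f) = - c f.
Proof. by rewrite -scaleN1r linZ scaleN1r. Qed.

Lemma linM a f : c (in_alg A a * f) = in_alg A a * c f.
Proof. by rewrite -!scale_alg linZ. Qed.

Lemma linMz n f : c (n%:~R * f) = n%:~R * c f.
Proof. by rewrite -(rmorph_int (in_alg A)) linM. Qed.

End Linearity.

Lemma cderiv_in_alg a : D (in_alg A a) = 0.
Proof. exact: cderiv_alg. Qed.

Lemma cderivz n : D n%:~R = 0.
Proof. by rewrite -(rmorph_int (in_alg A)) cderiv_in_alg. Qed.

Lemma density_cocycleB l c d : density_cocycle l c -> density_cocycle l d ->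
  density_cocycle l (fun f => c f - d f).
Proof.
move=> [cL cC] [dL dC]; split=> [a f g|f g].
  by rewrite cL dL scalerBr opprD addrACA.
by rewrite cC dC /density_act !cderivD !cderivN; ring.
Qed.

Lemma density_cocycleZ l a c : density_cocycle l c -> density_cocycle l (fun f => a *: c f).
Proof.
move=> [cL cC]; split=> [b f g|f g].
  by rewrite cL scalerDr !scalerA mulrC.
by rewrite cC /density_act !cderivZ !scale_alg; ring.
Qed.

Lemma density_cobound_cocycle l h : density_cocycle l (fun f => density_act l f h).
Proof.
split=> [a f g|f g]; rewrite /density_act.
  rewrite cderivD cderivZ !scale_alg; ring.
by rewrite !(cderivD, cderivN, cderivM, cderivz); ring.
Qed.

Lemma density_cocycle_id : density_cocycle 0 id.
Proof. by split=> // f g; rewrite /density_act; ring. Qed.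

Lemma density_cocycle_D1 : density_cocycle 0 D.
Proof.
split=> [a f g|f g]; first by rewrite cderivD cderivZ.
by rewrite /density_act !(cderivD, cderivN, cderivM); ring.
Qed.

Lemma density_cocycle_D2 : density_cocycle 1 (fun f => D (D f)).
Proof.
split=> [a f g|f g]; first by rewrite !cderivD !cderivZ.
by rewrite /density_act !(cderivD, cderivN, cderivM); ring.
Qed.

Lemma density_cocycle_D3 : density_cocycle 2 (fun f => D (D (D f))).
Proof.
split=> [a f g|f g]; first by rewrite !cderivD !cderivZ.
by rewrite /density_act !(cderivD, cderivN, cderivM); ring.
Qed.

(* Such a c commutes with d/dx. For l <> 1 this makes every exp(inx) c(g) a
   derivative. For l = 1, three brackets involving exp(+-ix) and g give
   exp(-ix) c(exp(ix) g) = c(g) and then 2 i c(g) = 0. *)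
Lemma density_cocycle_eq0 l c : density_cocycle l c ->
  (forall n, c (expi R n) = 0) -> forall g, c g = 0.
Proof.
move=> [cL cC] c0 g.
have cD u : c (D u) = D (c u).
  have := cC 1 u; rewrite /density_act -[c 1]/(c (expi R 0)) c0.
  by rewrite !mul1r cderiv1 raddf0 !mul0r !mulr0 !addr0 !subr0.
have cE n u : c (expi R n * D u - I * (n%:~R * (expi R n * u))) =
    expi R n * D (c u) + l%:~R * (I * n%:~R * expi R n * c u).
  have -> : expi R n * D u - I * (n%:~R * (expi R n * u)) = expi R n * D u - D (expi R n) * u.
    by rewrite cderiv_expiM; ring.
  by rewrite cC /density_act c0 raddf0 cderiv_expiM; ring.
have [l1|l1] := eqVneq l 1; last first.
  apply: Fourier_uniqueness => n.
  have exc u : is_exact (c u).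
    have [m [P ->]] := mean_decomposition u.
    rewrite (linD cL) (linZ cL) cD -[c 1]/(c (expi R 0)) c0 scaler0 add0r.
    by exists (c P).
  have [->|n0] := eqVneq n 0; first by rewrite mul1r; exact: exc.
  pose z : R[i] := (l - 1)%:~R * ('i%C * n%:~R).
  have z0 : z != 0.
    rewrite !mulf_neq0 ?intr_eq0 ?subr_eq0//.
    by rewrite eq_complex /= oner_eq0 andbF.
  have -> : expi R n * c g = z^-1 *: (z *: (expi R n * c g)).
    by rewrite scalerA mulVf// scale1r.
  apply: exactZ.
  (* Subtracting D (exp(inx) c(g)) from [cE] leaves exp(inx) c(g) with the factor (l - 1) i n, and
     every value of c is exact by [exc]. *)
  have -> : z *: (expi R n * c g) =
    c (expi R n * D g - I * (n%:~R * (expi R n * g))) + (-1) *: D (expi R n * c g).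
    rewrite cE cderivM cderiv_expiM scaleN1r /z !scale_alg; ring.
  by apply: exactD; [exact: exc|apply: exactZ; exists (expi R n * c g)].
have dE n : D (expi R n) = I * n%:~R * expi R n := cderiv_expiM n.
pose E := expi R 1; pose E' := expi R (-1).
have EE : E * E' = 1 by exact: expi_mulN.
pose u1 := E' * c (E * g).
have cEg : c (E * g) = E * u1 by rewrite /u1 mulrA EE mul1r.
clearbody u1.
have dE1 : D E = I * E by rewrite dE mulr1.
have dE1' : D E' = - (I * E') by rewrite dE mulrN1 mulNr.
subst l.
(* [e1] comes from the bracket of exp(-ix) with exp(ix) g, [cE1] from that of 1 with exp(ix) g, and
   [e2] from that of exp(ix) with g. Comparing [e1] and [e2] gives u1 = c g. *)
have e1 : D (c g) + 2 * I * c g = D u1.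
  have := cE (-1) (E * g); rewrite -/E' cEg.
  have -> : E' * D (E * g) - I * ((-1)%:~R * (E' * (E * g))) = D g + 2%:~R * (I * g).
    rewrite cderivM dE1; ring: EE.
  rewrite (linD cL) (linMz cL) (linM cL) cD cderivM dE1 => e.
  have -> : D u1 = (E * E') * D u1 by rewrite EE mul1r.
  apply: etrans (_ : _ = D (c g) + 2%:~R * (I * c g)) _; first by ring.
  by rewrite e; ring.
have cE1 : c (E * D g) = E * D u1.
  have := cD (E * g); rewrite cEg !cderivM !dE1 (linD cL) -mulrA (linM cL) cEg => e.
  by apply: (addrI (I * (E * u1))); rewrite e mulrA.
have e2 : D u1 = D (c g) + I * c g + I * u1.
  have := cE 1 g; rewrite -/E mulr1 !mul1r (linD cL) (linN cL) (linM cL) cE1 cEg => e.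
  have -> : D u1 = E' * (E * D u1 - I * (E * u1)) + I * u1 by ring: EE.
  by rewrite e; ring: EE.
have u1E : u1 = c g.
  have : I * c g = I * u1.
    apply: (addrI (D (c g) + I * c g)); rewrite -e2 -e1; ring.
  by move=> /(congr1 (fun u => - (I * u))); rewrite !mulrA imagM !mulN1r !opprK.
move: e1; rewrite u1E => /eqP; rewrite -subr_eq0 addrAC subrr add0r => /eqP e1.
apply/eqP; have : 2%:R *: c g == 0.
  rewrite scaler_nat -mulr_natl.
  have ii := imagM.
  have -> : 2 * c g = - I * (2 * I * c g).
    ring: ii.
  by rewrite e1 mulr0.
by rewrite scaler_eq0 pnatr_eq0.
Qed.

(* k n is the eigenvalue of the cocycle on exp(inx). *)
Lemma mode_recursion_eq0 l (k : int -> R[i]) :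
  (forall n m, (m - n)%:~R * k (n + m) = (m + l * n)%:~R * k m - (n + l * m)%:~R * k n) ->
  k 0 = 0 -> k 1 = 0 -> (l = 1 -> k (-1) = 0) -> (l = 2 -> k 2 = 0) ->
  forall n, k n = 0.
Proof.
move=> kE k0 k1 kN1 k2.
have solve (n m p a b c : int) : p = n + m -> m - n = a -> m + l * n = b -> n + l * m = c ->
  a%:~R * k p = b%:~R * k m - c%:~R * k n by move=> -> <- <- <-; exact: kE.
have cancel a x : a != 0 -> a%:~R * x = 0 :> R[i] -> x = 0.
  by move=> a0 /eqP; rewrite mulf_eq0 intr_eq0 (negbTE a0) => /eqP.
(* In the relation for (-1, 1), k (-1) has the factor l - 1; in the one for (-1, 2), k 2 has the
   factor 2 - l. Where these vanish the value is free, which leaves room for the classes of f'' and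
   f'''. *)
have kN1' : k (-1) = 0.
  have [l1|l1] := eqVneq l 1; first exact: kN1.
  have := @solve (-1) 1 0 2 (1 - l) (l - 1); rewrite k0 k1 !mulr0 sub0r => e.
  apply: (@cancel (l - 1)); first by rewrite subr_eq0.
  by apply: oppr_inj; rewrite -e ?oppr0//; lia.
have k2' : k 2 = 0.
  have [l2|l2] := eqVneq l 2; first exact: k2.
  have := @solve (-1) 2 1 3 (2 - l) (2 * l - 1); rewrite k1 kN1' !mulr0 subr0 => e.
  by apply: (@cancel (2 - l)); rewrite -?e//; lia.
have kN2 : k (-2) = 0.
  have [l2|l2] := eqVneq l 2.
    have := @solve (-2) 2 0 4 (- 2) 2; rewrite k0 k2' !mulr0 sub0r => e.
    apply: (@cancel 2) => //.
    by apply: oppr_inj; rewrite -e ?oppr0//; lia.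
  have := @solve 1 (-2) (-1) (-3) (l - 2) (1 - 2 * l); rewrite k1 kN1' !mulr0 subr0 => e.
  by apply: (@cancel (l - 2)); rewrite -?e//; lia.
(* The relation for (1, m) gives k (m + 1) the factor m - 1, nonzero from m = 2 on; hence k 2, and
   symmetrically k (-2), had to be settled first. *)
have kp (n : nat) : k n.+2 = 0.
  elim: n => // n IHn; have := @solve 1 n.+2%:Z n.+3%:Z n.+1%:Z (n.+2%:Z + l) (1 + l * n.+2%:Z).
  by rewrite k1 IHn !mulr0 subr0 => e; apply: (@cancel n.+1%:Z); rewrite ?e//; lia.
have kn (n : nat) : k (- n.+2%:Z) = 0.
  elim: n => // n IHn.
  have := @solve (-1) (- n.+2%:Z) (- n.+3%:Z) (- n.+1%:Z) (- n.+2%:Z - l) (-1 - l * n.+2%:Z).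
  by rewrite kN1' IHn !mulr0 subr0 => e; apply: (@cancel (- n.+1%:Z)); rewrite ?e//; lia.
move=> [[|[|n]]|[|n]] //; exact: kn.
Qed.

(** The bracket with 1 shows that c commutes with d/dx, so c preserves its eigenspaces, which are
    one-dimensional. *)
Lemma density_cocycle_mode l c n : density_cocycle l c -> c 1 = 0 ->
  exists a, c (expi R n) = in_alg A a * expi R n.
Proof.
move=> [cL cC] c1.
have cD u : c (D u) = D (c u).
  have := cC 1 u; rewrite /density_act c1.
  by rewrite !mul1r cderiv1 raddf0 !mul0r !mulr0 !addr0 !subr0.
have [a ca] : exists a, expi R (- n) * c (expi R n) = a%:A.
  apply: cderiv_eq0; rewrite cderivM -cD.
  have -> : c (D (expi R n)) = I * (n%:~R * c (expi R n)).
    by rewrite cderiv_expiM -mulrA (linM cL) (linMz cL).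
  by rewrite cderiv_expiM rmorphN; ring.
by exists a; rewrite -[in_alg A a]ca mulrC mulrA expi_mulN mul1r.
Qed.

(** Two cocycles agreeing on these few modes coincide, so [density_H1] only has to adjust finitely
    many numbers. *)
Lemma density_cocycle_modes l c : density_cocycle l c ->
  c 1 = 0 -> c (expi R 1) = 0 -> (l = 1 -> c (expi R (-1)) = 0) ->
  (l = 2 -> c (expi R 2) = 0) -> forall g, c g = 0.
Proof.
move=> cc c1 ce1 ceN1 ce2; apply: (density_cocycle_eq0 cc) => n.
have [cL cC] := cc.
have /choice[k ck] : forall m, exists a, c (expi R m) = in_alg A a * expi R m.
  by move=> m; exact: density_cocycle_mode cc c1.
suff kn0 : k n = 0 by rewrite ck kn0 rmorph0 mul0r.
have expi_inj a b m : in_alg A a * expi R m = in_alg A b * expi R m -> a = b.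
  move=> /(congr1 (fun u : A => (u * expi R (- m)) 0)).
  by rewrite -!mulrA expi_mulN !mulr1 !algE.
have k_eq0 m : c (expi R m) = 0 -> k m = 0.
  by rewrite ck -(mul0r (expi R m)) -(rmorph0 (in_alg A)) => /expi_inj.
apply: (@mode_recursion_eq0 l k) => //; try by move=> *; apply: k_eq0; auto.
move=> p q; apply: (@expi_inj _ _ (p + q)).
have := cC (expi R p) (expi R q); rewrite /density_act !ck !cderivM !cderiv_in_alg.
rewrite !cderiv_expiM !mul0r !add0r.
have -> : expi R p * (I * q%:~R * expi R q) - I * p%:~R * expi R p * expi R q =
   I * ((q - p)%:~R * expi R (p + q)) by rewrite expiD; ring.
rewrite (linM cL) (linMz cL) ck => /(congr1 (fun u => - I * u)).
rewrite expiD => e.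
have -> : in_alg A ((q - p)%:~R * k (p + q)) * (expi R p * expi R q) = 
  - I * (I * ((q - p)%:~R * (in_alg A (k (p + q)) * (expi R p * expi R q)))).
  ring: imagM.
rewrite e; ring: imagM.
Qed.

(* b matters only for l = 0, the one weight with two independent classes. *)
Definition density_class l (a b : R[i]) f : A :=
  if l == 0 then a *: f + b *: D f
  else if l == 1 then a *: D (D f)
  else if l == 2 then a *: D (D (D f)) else 0.

Lemma density_class_cocycle l a b : density_cocycle l (density_class l a b).
Proof.
rewrite /density_class; have [->|_] := eqVneq l 0.
  have := density_cocycleB (density_cocycleZ a density_cocycle_id)
    (density_cocycleZ (- b) density_cocycle_D1).
  by congr density_cocycle; apply/funext => f; rewrite scaleNr opprK.
have [->|_] := eqVneq l 1; first exact: density_cocycleZ density_cocycle_D2.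
have [->|_] := eqVneq l 2; first exact: density_cocycleZ density_cocycle_D3.
by split=> *; rewrite /density_act ?scaler0 ?raddf0 !(mulr0, addr0, subr0).
Qed.

Lemma density_H1 l c : density_cocycle l c ->
  exists h a b, forall f, c f = density_act l f h + density_class l a b f.
Proof.
move=> cc; have [cL cC] := cc.
have [m [h0 c1E]] := mean_decomposition (c 1).
have c0c := density_cocycleB cc (density_cobound_cocycle l h0).
set c0 := (X in density_cocycle l X) in c0c.
have c01 : c0 1 = in_alg A m.
  by rewrite /c0 c1E /density_act cderiv1 mul1r mul0r mulr0 addr0 addrK.
(* The bracket of 1 with exp(ix) exhibits the constant l i m as a derivative. *)
have lm : l != 0 -> m = 0.
  move=> l0; have [c0L c0C] := c0c; pose u := c0 (expi R 1).
  have E1 : expi R (-1) * expi R 1 = 1 by rewrite mulrC expi_mulN.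
  have : is_exact (l%:~R * 'i%C * m)%:A.
    exists (expi R (-1) * u).
    have := c0C 1 (expi R 1).
    rewrite cderiv1 mul0r subr0 mul1r /density_act c01 cderiv_in_alg cderiv1.
    rewrite cderiv_expiM mulr1 (linM c0L) -/u cderivM cderiv_expiM => e.
    rewrite -[_%:A]/(in_alg A _) !rmorphM rmorph_int.
    have -> : D u = I * u + l%:~R * (I * expi R 1 * in_alg A m) by rewrite e; ring.
    by rewrite rmorphN1; ring: E1.
  move=> /exact_alg /eqP; rewrite !mulf_eq0 intr_eq0 (negbTE l0) /=.
  have -> : ('i%C == 0 :> R[i]) = false by rewrite eq_complex /= oner_eq0 andbF.
  by move/eqP.
have c1c := density_cocycleB c0c (density_class_cocycle l (if l == 0 then m else 0) 0).
set c1 := (X in density_cocycle l X) in c1c.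
have c11 : c1 1 = 0.
  rewrite /c1 c01 /density_class cderiv1 scale0r; have [_|/lm ->] := eqVneq l 0.
    by rewrite addr0 subrr.
  by rewrite !raddf0 ?scale0r ?scaler0 !if_same ?subrr.
have [a1 ca1] := density_cocycle_mode 1 c1c c11.
have [aN caN] := density_cocycle_mode (-1) c1c c11.
have [a2 ca2] := density_cocycle_mode 2 c1c c11.
(* On exp(inx) the coboundary of a constant t has eigenvalue l i n t, and the class of a has (in)^2
   a for l = 1 and (in)^3 a for l = 2. Matching the modes 1, -1, respectively 1, 2, is a 2 by 2
   linear system for t and a, solved by the witnesses below. For l = 0 the class of f' fits mode 1;
   in the remaining weights t does. *)
suff [t [a [b [e0 e1 eN e2]]]] : exists t a b,
  let r := fun f => density_act l f t%:A + density_class l a b f in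
  [/\ r 1 = 0, r (expi R 1) = in_alg A a1 * expi R 1,
    l = 1 -> r (expi R (-1)) = in_alg A aN * expi R (-1) &
    l = 2 -> r (expi R 2) = in_alg A a2 * expi R 2].
  have := density_cocycleB (density_cocycleB c1c (density_cobound_cocycle l t%:A))
    (density_class_cocycle l a b).
  move=> /density_cocycle_modes c3.
  have {c3} r0 f : c1 f - density_act l f t%:A - density_class l a b f = 0.
    apply: c3 f.
    - by rewrite -addrA -opprD e0 c11 subr0.
    - by rewrite -addrA -opprD e1 ca1 subrr.
    - by move=> /eN e; rewrite -addrA -opprD e caN subrr.
    - by move=> /e2 e; rewrite -addrA -opprD e ca2 subrr.
  exists (h0 + t%:A), (a + if l == 0 then m else 0), b => f; apply/eqP.
  rewrite -subr_eq0; apply/eqP; rewrite -[RHS](r0 f) /c1 /c0.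
  rewrite /density_class /density_act cderivD.
  case: (eqVneq l 0) => _; [|case: ifP => _; [|case: ifP => _]];
    by rewrite ?addr0 !scale_alg ?rmorphD ?rmorph0; ring.
have i0 : 'i%C != 0 :> R[i] by rewrite eq_complex /= oner_eq0 andbF.
have ii := sqr_i R.
have dact t n : density_act l (expi R n) t%:A =
    in_alg A (l%:~R * 'i%C * n%:~R * t) * expi R n.
  rewrite /density_act cderiv_alg cderiv_expiM -[t%:A]/(in_alg A t) mulr0 add0r.
  by rewrite !rmorphM !rmorph_int; ring.
have dact1 t : density_act l 1 t%:A = 0.
  by rewrite /density_act cderiv_alg cderiv1 mul0r !mulr0 addr0.
have D2e n : D (D (expi R n)) = in_alg A (('i%C * n%:~R) ^+ 2) * expi R n.
  by rewrite !(cderiv_expi, cderivZ) scalerA scale_alg -expr2.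
have D3e n : D (D (D (expi R n))) = in_alg A (('i%C * n%:~R) ^+ 3) * expi R n.
  by rewrite !(cderiv_expi, cderivZ) !scalerA scale_alg; congr (in_alg A _ * _); ring.
rewrite /density_class; have [l0|l0] := eqVneq l 0.
  exists 0, 0, (a1 / 'i%C); split; try by rewrite l0.
    by rewrite dact1 cderiv1 scaler0 scale0r !addr0.
  rewrite dact mulr0 rmorph0 mul0r scale0r !add0r cderiv_expi scalerA scale_alg.
  by congr (in_alg A _ * _); rewrite mulr1 divfK.
have [l1|l1] := eqVneq l 1.
  exists ((a1 - aN) / (2 * 'i%C)), (- (a1 + aN) / 2), 0; split; try by rewrite l1.
  - by rewrite dact1 cderiv1 raddf0 scaler0 addr0.
  - rewrite dact D2e l1 scale_alg mulrA -rmorphM -mulrDl -rmorphD.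
    by congr (in_alg A _ * _); rewrite exprMn ii; field.
  - move=> _; rewrite dact D2e l1 scale_alg mulrA -rmorphM -mulrDl -rmorphD.
    by congr (in_alg A _ * _); rewrite exprMn ii rmorphN1; field.
have [l2|l2] := eqVneq l 2.
  pose b := (2 * a1 - a2) / (6 * 'i%C).
  exists ((a1 + 'i%C * b) / (2 * 'i%C)), b, 0; split; try by rewrite l2.
  - by rewrite dact1 cderiv1 !raddf0 addr0.
  - rewrite dact D3e l2 scale_alg mulrA -rmorphM -mulrDl -rmorphD.
    by congr (in_alg A _ * _); rewrite exprMn exprS ii /b; field.
  - move=> _; rewrite dact D3e l2 scale_alg mulrA -rmorphM -mulrDl -rmorphD.
    by congr (in_alg A _ * _); rewrite exprMn exprS ii /b; field.
exists (a1 / (l%:~R * 'i%C)), 0, 0; split.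
- by rewrite dact1 addr0.
- rewrite dact addr0; congr (in_alg A _ * _); rewrite mulr1; field.
  by rewrite i0 intr_eq0.
- by move=> /eqP; rewrite (negbTE l1).
- by move=> /eqP; rewrite (negbTE l2).
Qed.

End DensityCocycles.

(** * Binomial coefficients *)

Section RisingBinomials.
Variable R : realType.

(* The binomial coefficient C(p + k, k) for an integer p of any sign. *)
Definition rbin (p : int) (k : nat) : R[i] :=
  (\prod_(r < k) (p + r.+1%:Z)%:~R) / k`!%:R.

Lemma rbin0 p : rbin p 0 = 1.
Proof. by rewrite /rbin big_ord0 divr1. Qed.

Lemma fact_neq0 k : k`!%:R != 0 :> R[i].
Proof. by rewrite pnatr_eq0 -lt0n fact_gt0. Qed.

Lemma rbin1 p : rbin p 1 = (p + 1)%:~R.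
Proof. by rewrite /rbin big_ord1 divr1. Qed.

Lemma rbin_pascal p k : rbin p k.+1 = rbin (p - 1) k.+1 + rbin p k.
Proof.
rewrite /rbin; set q := \prod_(r < k) (p + r.+1%:Z)%:~R.
have -> : \prod_(r < k.+1) (p + r.+1%:Z)%:~R = q * (p + k.+1%:Z)%:~R :> R[i].
  by rewrite big_ord_recr.
have -> : \prod_(r < k.+1) (p - 1 + r.+1%:Z)%:~R = p%:~R * q :> R[i].
  rewrite big_ord_recl /= subrK; congr (_ * _).
  by apply: eq_bigr => i _; congr (_%:~R); rewrite /bump /=; lia.
have k0 := fact_neq0 k; have k1 : k.+1%:R != 0 :> R[i] by rewrite pnatr_eq0.
rewrite factS natrM rmorphD /= -[(k.+1%:Z)%:~R]/(k.+1%:R : R[i]); field.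
by rewrite k0 addrC natr1.
Qed.

(** Trinomial revision for a possibly negative upper index; it carries the associativity in
    [rmul_rmul]. *)
Lemma rbinM p i j : rbin p i * rbin (p + i%:Z) j = rbin p (i + j) * 'C(i + j, i)%:R.
Proof.
have bf : (i + j)`!%:R = 'C(i + j, i)%:R * (i`!%:R * j`!%:R) :> R[i].
  by rewrite -!natrM -(bin_fact (leq_addr j i)) addKn.
rewrite /rbin big_split_ord /= bf.
have -> : \prod_(r < j) (p + i%:Z + r.+1%:Z)%:~R =
          \prod_(r < j) (p + (i + r).+1%:Z)%:~R :> R[i].
  by apply: eq_bigr => r _; congr (_%:~R); lia.
have := fact_neq0 i; have := fact_neq0 j.
have c0 : 'C(i + j, i)%:R != 0 :> R[i] by rewrite pnatr_eq0 -lt0n bin_gt0 leq_addr.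
move=> j0 i0; field.
by rewrite i0 j0 c0.
Qed.

Lemma sum_triangle (V : nmodType) n (G : nat -> nat -> V) :
  (forall i j, (n <= i + j)%N -> G i j = 0) ->
  \sum_(i < n) \sum_(j < n) G i j = \sum_(q < n) \sum_(i < q.+1) G i (q - i)%N.
Proof.
move=> G0.
transitivity (\sum_(q < n) \sum_(i < n | (i <= q)%N) G i (q - i)%N); last first.
  apply: eq_bigr => q _.
  rewrite (big_ord_widen_cond n xpredT (fun i => G i (q - i)%N)) //.
rewrite [RHS](exchange_big_dep xpredT) //=; apply: eq_bigr => i _.
rewrite -(big_mkord xpredT (fun j => G i j)) -(big_mkord (fun q => i <= q)%N (fun q => G i (q - i)%N)).
rewrite (big_cat_nat (n := (n - i)%N)) ?leq_subr//=.
have -> : \sum_(n - i <= j < n) G i j = 0.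
  by rewrite big_nat big1 // => j /andP[ij _]; apply: G0; rewrite -leq_subLR.
rewrite addr0.
rewrite [RHS](big_cat_nat (n := i)) ?(ltnW (ltn_ord i))//=.
have -> : \sum_(0 <= q < i | (i <= q)%N) G i (q - i)%N = 0.
  by rewrite big_nat_cond big_pred0 // => q; rewrite ltnNge; case: (i <= q)%N.
rewrite add0r.
rewrite [RHS](_ : _ = \sum_(0 + i <= q < n | (i <= q)%N) G i (q - i)%N) // big_addn.
rewrite big_nat [RHS]big_nat_cond; apply: eq_big => [j|j _]; last by rewrite addnK.
by rewrite leq_addl andbT.
Qed.

End RisingBinomials.

(** * The adjoint action on symbols *)

Section Symbols.
Variable R : realType.
Local Notation A := (Csmooth R).
Local Notation D := (@cderiv R).
Local Notation series := (int -> A).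
Implicit Types (f g h : A) (F G : series) (P Q : PsiD R) (N m p : int) (n k : nat).

Definition rb p k : A := in_alg A (rbin R p k).

Lemma rb0 p : rb p 0 = 1.
Proof. by rewrite /rb rbin0 rmorph1. Qed.

Lemma rb1 p : rb p 1 = (p + 1)%:~R.
Proof. by rewrite /rb rbin1 rmorph_int. Qed.

Lemma rb_pascal p k : rb p k.+1 = rb (p - 1) k.+1 + rb p k.
Proof. by rewrite /rb rbin_pascal rmorphD. Qed.

Lemma rbM p i j : rb p i * rb (p + i%:Z) j = rb p (i + j) * 'C(i + j, i)%:R.
Proof. by rewrite /rb -rmorphM rbinM rmorphM rmorph_nat. Qed.

(* The symbol of F o f is rmul f F, of the multiplication of F by xi it is
   shift F, and of d/dx o F it is dleft F. *)
Definition rmul f F : series := compose F (monomial f 0).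
Definition shift F : series := fun m => F (m - 1).
Definition dleft F : series := fun m => F (m - 1) + D (F m).

Lemma iter_dxiE n F p :
  iter n (@dxi R) F p = (\prod_(r < n) (p + r.+1%:Z)%:~R) *: F (p + n%:Z).
Proof.
elim: n p => [|n IHn] p; first by rewrite big_ord0 scale1r addr0.
rewrite /= /dxi IHn scalerA big_ord_recl /=; congr (_ * _ *: F _); last by lia.
by apply: eq_bigr => i _; congr (_%:~R); rewrite /bump /=; lia.
Qed.

Lemma dx_monomial f j : dx (monomial f j) = monomial (D f) j.
Proof.
by apply/funext => m; rewrite /dx /=; case: ifP => // _; rewrite raddf0.
Qed.

Lemma iter_dx_monomial n f j : iter n (@dx R) (monomial f j) = monomial (iter n D f) j.
Proof. by elim: n => // n IHn; rewrite iterS IHn dx_monomial. Qed.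

Lemma commutative_mul_monomialr F f j m :
  commutative_mul F (monomial f j) m = F (m - j) * f.
Proof.
rewrite /commutative_mul (fsbigE [:: m - j]) //.
  by rewrite big_mkcond big_seq1 in_setT /= subKr eqxx.
move=> i _; rewrite inE => ij /=; case: eqP => [e|]; last by rewrite mulr0.
by case/negP: ij; rewrite -e subKr.
Qed.

Lemma commutative_mul_monomiall F f j m :
  commutative_mul (monomial f j) F m = f * F (m - j).
Proof.
rewrite /commutative_mul (fsbigE [:: j]) //.
  by rewrite big_mkcond big_seq1 in_setT /= eqxx.
by move=> i _; rewrite inE => ij /=; rewrite (negbTE ij) mul0r.
Qed.

Lemma compose_monomialr N n f j F m : vanishes_above N F -> N + j - m < n%:Z ->
  compose F (monomial f j) m = \sum_(k < n) rb (m - j) k * (iter k D f * F (m - j + k%:Z)).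
Proof.
move=> F0 nP; have m0 : vanishes_above j (monomial f j).
  by move=> i ji /=; rewrite gt_eqF.
rewrite (composeE F0 m0 nP); apply: eq_bigr => k _.
rewrite iter_dx_monomial commutative_mul_monomialr iter_dxiE -scalerAl scalerA.
by rewrite /rb -scale_alg mulrC /rbin mulrC; congr (_ *: _); rewrite mulrC.
Qed.

Lemma rmulE N n f F p : vanishes_above N F -> N - p < n%:Z ->
  rmul f F p = \sum_(k < n) rb p k * (iter k D f * F (p + k%:Z)).
Proof.
move=> F0 nP; rewrite /rmul (compose_monomialr f (j := 0) F0 (n := n)) ?addr0//.
Qed.

Lemma compose_monomial1 f F m : compose (monomial f 1) F m = f * dleft F m.
Proof.
rewrite /compose (fsbigE [:: 0%N; 1%N]) //.
  rewrite big_mkcond big_cons big_seq1 !in_setT /= !fact0 !invr1 !scale1r.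
  rewrite commutative_mul_monomiall /dleft mulrDr; congr (_ + _).
  have -> : dxi (monomial f 1) = monomial f 0.
    apply/funext => i; rewrite /dxi /=.
    have -> : (i + 1 == 1) = (i == 0) by apply/eqP/eqP; lia.
    by case: eqP => [->|_]; rewrite ?scaler0// add0r scale1r.
  by rewrite commutative_mul_monomiall subr0 /dx.
move=> k _; rewrite !inE negb_or => /andP[k0 k1].
have -> : iter k (@dxi R) (monomial f 1) = monomial 0 0.
  apply/funext => i; rewrite iter_dxiE /= if_same; case: eqP => [ik|_]; last by rewrite scaler0.
  case: k k0 k1 ik => // -[//|k] _ _ ik.
  have -> : i = - k.+1%:Z by lia.
  by rewrite big_ord_recr big_ord_recr /= addNr mulr0 mul0r scale0r.
by rewrite commutative_mul_monomiall mul0r scaler0.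
Qed.

(** [Vect_act] extended to complexified vector fields. *)
Definition cact f P := PsiD_bracket (monomial f 1) P.

Lemma compose_monomial1r f P m : compose P (monomial f 1) m = shift (rmul f P) m.
Proof.
have /bounded_orderP[N P0] := valP P; pose n := `|(N + 1 - m)%R|%N.+1.
rewrite /shift (@rmulE N n _ _ _ P0); last by rewrite /n; lia.
by rewrite (@compose_monomialr N n _ _ _ _ P0)//; rewrite /n; lia.
Qed.

(** As f xi = f o xi, the left product is f times xi o P, and the right product is (P o f) o xi,
    where the last composition merely shifts the index. *)
Lemma cactE f P m : cact f P m = f * dleft P m - rmul f P (m - 1).
Proof.
rewrite -[LHS]/(compose (monomial f 1) P m - compose P (monomial f 1) m).
by rewrite compose_monomial1 compose_monomial1r.
Qed.

Lemma vanishes_rmul N f F : vanishes_above N F -> vanishes_above N (rmul f F).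
Proof. by move=> F0 p Np; rewrite (@rmulE N 0 _ _ _ F0) ?big_ord0// subr_lt0. Qed.

Lemma vanishes_cact N f P : vanishes_above N P -> vanishes_above N (cact f P).
Proof.
move=> P0 m Nm; rewrite cactE /dleft !(P0 m)// raddf0 addr0.
rewrite (@rmulE N 1 _ _ _ P0) ?big_ord1; last by lia.
by rewrite rb0 mul1r addr0 subrr.
Qed.

(** The two terms f P_(N-1) cancel; what remains of P o f is its first-order term N f' P_N, whence
    the weight -N. *)
Lemma cact_top N f P : vanishes_above N P ->
  cact f P N = density_act (- N) f (P N).
Proof.
move=> P0; rewrite cactE (@rmulE N 2 _ _ _ P0); last by lia.
rewrite !big_ord_recl big_ord0 /= rb0 rb1 !subrK addr0 /dleft /density_act.
ring.
Qed.

Lemma vanishes_dleft N F : vanishes_above N F -> vanishes_above (N + 1) (dleft F).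
Proof.
by move=> F0 m Nm; rewrite /dleft !F0 ?raddf0 ?addr0//; lia.
Qed.

Lemma vanishes_shift N F : vanishes_above N F -> vanishes_above (N + 1) (shift F).
Proof. by move=> F0 m Nm; rewrite /shift F0//; lia. Qed.

Lemma rmul_linl N f g F p : vanishes_above N F ->
  rmul (f - g) F p = rmul f F p - rmul g F p.
Proof.
move=> F0; have nP : N - p < `|(N - p)%R|%N.+1%:Z by lia.
rewrite !(rmulE _ F0 nP) -sumrB; apply: eq_bigr => k _.
have -> : iter k D (f - g) = iter k D f - iter k D g.
  by elim: (nat_of_ord k) => //= i ->; rewrite raddfB.
by ring.
Qed.

Lemma iter_cderivM n f g : iter n D (f * g) =
  \sum_(i < n.+1) 'C(n, i)%:R * (iter i D f * iter (n - i) D g).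
Proof.
elim: n => [|n IHn]; first by rewrite big_ord1 mul1r.
rewrite iterS IHn raddf_sum.
have dnat k u : D (k%:R * u) = k%:R * D u by rewrite cderivM -(rmorph_nat (in_alg A)) cderiv_in_alg mul0r add0r.
transitivity (\sum_(i < n.+1) ('C(n, i)%:R * (iter i.+1 D f * iter (n - i) D g) +
  'C(n, i)%:R * (iter i D f * iter (n.+1 - i) D g))).
  apply: eq_bigr => i _; rewrite /= dnat cderivM mulrDr.
  by rewrite subSn ?iterS// -ltnS.
rewrite big_split /= big_ord_recr [in X in _ + X]big_ord_recl [RHS]big_ord_recl.
rewrite [in RHS]big_ord_recr.
pose t1 (i : 'I_n) := 'C(n, i)%:R * (iter i.+1 D f * iter (n - i) D g).
pose t2 (i : 'I_n) := 'C(n, i.+1)%:R * (iter i.+1 D f * iter (n - i) D g).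
have -> : \sum_(i < n) 'C(n.+1, lift ord0 (widen_ord (leqnSn n) i))%:R *
    (iter (lift ord0 (widen_ord (leqnSn n) i)) D f *
     iter (n.+1 - lift ord0 (widen_ord (leqnSn n) i)) D g) =
    \sum_(i < n) t1 i + \sum_(i < n) t2 i.
  rewrite -big_split; apply: eq_bigr => i _.
  by rewrite /t1 /t2 /= /bump leq0n add1n subSS binS natrD; ring.
rewrite /= /bump leq0n add1n !bin0 !binn subnn.
rewrite -/(\sum_(i < n) t1 i) -/(\sum_(i < n) t2 i) add0n subnn /=; ring.
Qed.

(** Associativity (F o g) o f = F o (g f): collect the double sum by the total number q of
    derivatives, then apply Leibniz's rule. *)
Lemma rmul_rmul N f g F p : vanishes_above N F ->
  rmul f (rmul g F) p = rmul (f * g) F p.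
Proof.
move=> F0; set n := `|(N - p)%R|%N.+1; have nP : N - p < n%:Z by lia.
rewrite (rmulE _ (vanishes_rmul g F0) nP) (rmulE _ F0 nP).
pose G (i j : nat) := rb p (i + j) * ('C(i + j, i)%:R * (iter i D f * iter j D g)) * F (p + (i + j)%:Z).
transitivity (\sum_(i < n) \sum_(j < n) G i j).
  apply: eq_bigr => i _.
  rewrite (@rmulE N n _ _ _ F0); last by lia.
  rewrite !mulr_sumr; apply: eq_bigr => j _; rewrite /G.
  have -> : p + i%:Z + j%:Z = p + (i + j)%:Z by lia.
  have := rbM p i j.
  move: (rb _ _) (rb _ _) (rb _ _) (iter _ _ _) (iter _ _ _) (F _) (_%:R).
  move=> x1 x2 x3 x4 x5 x6 x7 e.
  by transitivity ((x3 * x2) * (x4 * x5) * x6); [ring|rewrite e; ring].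
rewrite (@sum_triangle A n G) => [|i j ij]; last first.
  by rewrite /G F0 ?mulr0//; lia.
apply: eq_bigr => q _; rewrite iter_cderivM mulr_suml mulr_sumr.
apply: eq_bigr => i _; rewrite /G subnKC; last by rewrite -ltnS.
by rewrite -mulrA; congr (_ * (_ * _)).
Qed.

(** The relation xi o f = f xi + f' composed with F on the left; on coefficients it is Pascal's
    rule. *)
Lemma rmul_shift N f F p : vanishes_above N F ->
  rmul f (shift F) p = rmul f F (p - 1) + rmul (D f) F p.
Proof.
move=> F0; have [n nP] : exists n : nat, N - p + 1 < n%:Z.
  by exists `|(N - p + 1)%R|%N.+1; lia.
rewrite (@rmulE _ n.+1 _ _ _ (vanishes_shift F0)); last by lia.
rewrite (@rmulE _ n.+1 _ _ _ F0); last by lia.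
rewrite (@rmulE _ n _ _ _ F0); last by lia.
rewrite big_ord_recl [in RHS]big_ord_recl !rb0 /shift -[RHS]addrA -big_split /=; congr (_ + _).
  by congr (_ * (_ * F _)); lia.
apply: eq_bigr => i _; rewrite /bump leq0n add1n rb_pascal.
have -> : p + i.+1%:Z - 1 = p + i%:Z by lia.
have -> : p - 1 + i.+1%:Z = p + i%:Z by lia.
by rewrite -iterS -iterSr; ring.
Qed.

Lemma rmul_mull N f g F p : vanishes_above N F ->
  rmul f (fun m => g * F m) p = g * rmul f F p.
Proof.
move=> F0; have nP : N - p < `|(N - p)%R|%N.+1%:Z by lia.
have gF0 : vanishes_above N (fun m => g * F m) by move=> m /F0 ->; rewrite mulr0.
rewrite (rmulE _ F0 nP) (rmulE _ gF0 nP) mulr_sumr; apply: eq_bigr => k _; ring.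
Qed.

Lemma cderiv_rmul N f F p : vanishes_above N F ->
  D (rmul f F p) = rmul (D f) F p + rmul f (fun m => D (F m)) p.
Proof.
move=> F0; have nP : N - p < `|(N - p)%R|%N.+1%:Z by lia.
have dF0 : vanishes_above N (fun m => D (F m)) by move=> m /F0 ->; rewrite raddf0.
rewrite !(rmulE _ F0 nP) (rmulE _ dF0 nP) raddf_sum -big_split; apply: eq_bigr => k _ /=.
by rewrite !cderivM [D (rb _ _)]cderiv_in_alg -iterS -iterSr; ring.
Qed.

Lemma rmulD N f F G p : vanishes_above N F -> vanishes_above N G ->
  rmul f (fun m => F m + G m) p = rmul f F p + rmul f G p.
Proof.
move=> F0 G0; have nP : N - p < `|(N - p)%R|%N.+1%:Z by lia.
have FG0 : vanishes_above N (fun m => F m + G m).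
  by move=> m Nm; rewrite F0 ?G0 ?addr0.
rewrite (rmulE _ F0 nP) (rmulE _ G0 nP) (rmulE _ FG0 nP) -big_split.
by apply: eq_bigr => k _ /=; ring.
Qed.

Lemma rmulN N f F p : vanishes_above N F ->
  rmul f (fun m => - F m) p = - rmul f F p.
Proof.
move=> F0; have nP : N - p < `|(N - p)%R|%N.+1%:Z by lia.
have F0' : vanishes_above N (fun m => - F m) by move=> m /F0 ->; rewrite oppr0.
by rewrite (rmulE _ F0 nP) (rmulE _ F0' nP) -sumrN; apply: eq_bigr => k _; ring.
Qed.

Lemma dleft_rmul N f F p : vanishes_above N F ->
  dleft (rmul f F) p = rmul f (dleft F) p.
Proof.
move=> F0; have dF0 : vanishes_above (N + 1) (fun m => D (F m)).
  by move=> m Nm; rewrite F0 ?raddf0//; lia.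
rewrite (rmulD f p (vanishes_shift F0) dF0) (rmul_shift f p F0).
by rewrite /dleft (cderiv_rmul f p F0) addrA.
Qed.

(** In the expansion [cact2] of a double action every term is symmetric in u and v, apart from u v'
    times xi o P and the term P o (u' v). Antisymmetrizing these two gives the action of the
    bracket. *)
Lemma cact_rep f g P :
  cact (f * D g - D f * g) P = cact f (cact g P) - cact g (cact f P).
Proof.
have /bounded_orderP[N P0] := valP P.
have EP0 := vanishes_dleft P0.
have cact2 u v m : cact u (cact v P) m =
    u * (v * dleft (dleft P) m + D v * dleft P m) - (u * rmul v (dleft P) (m - 1)
    + v * rmul u (dleft P) (m - 1)) + (rmul (u * v) P (m - 1 - 1) + rmul (D u * v) P (m - 1)).
  have E1 : dleft (cact v P) m = v * dleft (dleft P) m + D v * dleft P m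
      - rmul v (dleft P) (m - 1).
    rewrite -(dleft_rmul v _ P0) [LHS]/dleft !cactE cderivD cderivN cderivM.
    by rewrite /dleft; ring.
  rewrite cactE E1.
  have E2 p : rmul u (cact v P) p =
     v * rmul u (dleft P) p - rmul (u * v) P (p - 1) - rmul (D u * v) P p.
    have vE0 : vanishes_above (N + 1) (fun m => v * dleft P m).
      by move=> q /EP0 ->; rewrite mulr0.
    have T0 := vanishes_rmul v P0.
    have S0 : vanishes_above (N + 1) (fun m => - shift (rmul v P) m).
      by move=> q /(vanishes_shift T0) ->; rewrite oppr0.
    have -> : coeff (cact v P) = fun m => v * dleft P m + - shift (rmul v P) m.
      by apply/funext => q; rewrite cactE.
    rewrite (rmulD u p vE0 S0) (rmulN u p (vanishes_shift T0)).
    rewrite (rmul_mull _ _ _ EP0) (rmul_shift _ _ T0) !(rmul_rmul _ _ _ P0).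
    by rewrite opprD addrA.
  by rewrite E2; ring.
apply/val_inj/funext => m; rewrite -[RHS]/(cact f (cact g P) m - cact g (cact f P) m).
rewrite !cact2 [LHS]cactE (rmul_linl _ _ _ P0) [g * f]mulrC.
rewrite [D g * f]mulrC; ring.
Qed.

End Symbols.

(** * Cocycles with values in symbols *)

Section SymbolCocycles.
Variable R : realType.
Local Notation A := (Csmooth R).
Local Notation D := (@cderiv R).
Implicit Types (f g h u v : A) (P Q F : PsiD R) (z w : A -> PsiD R) (N m p : int) (n k : nat).

Lemma cactZ f a P Q : cact f (a *: P + Q) = a *: cact f P + cact f Q.
Proof. exact: PsiD_bracket_is_linear. Qed.

Lemma cact0 f : cact f 0 = 0.
Proof. by have := cactZ f (-1) 0 0; rewrite scaler0 addr0 scaleN1r addNr. Qed.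

Lemma cactD f P Q : cact f (P + Q) = cact f P + cact f Q.
Proof. by have := cactZ f 1 P Q; rewrite !scale1r. Qed.

Lemma cactB f P Q : cact f (P - Q) = cact f P - cact f Q.
Proof. by rewrite -scaleN1r addrC cactZ scaleN1r addrC. Qed.

Lemma cact_linl F a f g : cact (a *: f + g) F = a *: cact f F + cact g F.
Proof.
apply/val_inj/funext => m; have /bounded_orderP[N F0] := valP F.
rewrite -[RHS]/(a *: cact f F m + cact g F m) [LHS]cactE !cactE.
have nP : N - (m - 1) < `|(N - (m - 1))%R|%N.+1%:Z by lia.
rewrite !(rmulE _ F0 nP) !scale_alg.
have := cderiv_in_alg a; move: (in_alg A a) => x Dx.
have -> : \sum_(k < `|(N - (m - 1))%R|.+1)
      rb R (m - 1) k * (iter k D (x * f + g) * F (m - 1 + k%:Z)) =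
  x * (\sum_(k < `|(N - (m - 1))%R|.+1)
      rb R (m - 1) k * (iter k D f * F (m - 1 + k%:Z))) +
  \sum_(k < `|(N - (m - 1))%R|.+1)
      rb R (m - 1) k * (iter k D g * F (m - 1 + k%:Z)).
  rewrite mulr_sumr -big_split; apply: eq_bigr => k _ /=.
  have -> : iter k D (x * f + g) = x * iter k D f + iter k D g.
    elim: (nat_of_ord k) => //= i ->.
    by rewrite cderivD cderivM Dx mul0r add0r.
  by ring.
by ring.
Qed.

Definition ccocycle z :=
  [/\ forall a f g, z (a *: f + g) = a *: z f + z g,
      exists N, forall f, vanishes_above N (z f) &
      forall f g, z (f * D g - D f * g) = cact f (z g) - cact g (z f)].

Lemma ccocycle_lin a z w : ccocycle z -> ccocycle w -> ccocycle (fun f => a *: z f + w f).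
Proof.
move=> [zL [N zN] zC] [wL [M wM] wC]; split=> [b f g||f g].
- by rewrite zL wL !scalerDr !scalerA [a * b]mulrC addrACA.
- exists (Num.max N M) => f; apply: vanishes_above_lin.
    by apply: vanishes_aboveW (zN f); rewrite le_max lexx.
  by apply: vanishes_aboveW (wM f); rewrite le_max lexx orbT.
- rewrite zC wC !cactZ; move: (cact _ _) (cact _ _) (cact _ _) (cact _ _) => X Y U V.
  by rewrite scalerBr opprD; exact: addrACA.
Qed.

Lemma ccobound_ccocycle F : ccocycle (fun f => cact f F).
Proof.
split=> [a f g||f g]; [exact: cact_linl| |exact: cact_rep].
have /bounded_orderP[N F0] := valP F.
by exists N => f; exact: vanishes_cact.
Qed.

(* The terms f^(n) xi^(1-n), one for each n, weighted by the sequence s. *)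
Definition jet_coeff (s : nat -> R[i]) f (k : int) : A :=
  if k <= 1 then s `|1 - k|%N *: iter `|1 - k|%N D f else 0.

Fact jet_subproof s f : jet_coeff s f \in @bounded_order R.
Proof.
by apply/bounded_orderP; exists 1 => k k1; rewrite /jet_coeff leNgt k1.
Qed.

Definition jet s f : PsiD R := MkPsiD (jet_subproof s f).

Lemma jet_vanishes s f : vanishes_above 1 (jet s f).
Proof. by move=> k k1; rewrite -[LHS]/(jet_coeff s f k) /jet_coeff leNgt k1. Qed.

Lemma jetE s f n : jet s f (1 - n%:Z) = in_alg A (s n) * iter n D f.
Proof.
rewrite -[LHS]/(jet_coeff s f (1 - n%:Z)) /jet_coeff.
have -> : 1 - n%:Z <= 1 by lia.
have -> : `|(1 - (1 - n%:Z))%R|%N = n by lia.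
by rewrite scale_alg.
Qed.

(** Upper negation of the binomial coefficient; the value vanishes for k > n. *)
Lemma rbN n k : rb R (- n.+1%:Z) k = (-1) ^+ k * 'C(n, k)%:R.
Proof.
rewrite /rb.
have -> : rbin R (- n.+1%:Z) k = (-1) ^+ k * 'C(n, k)%:R.
  rewrite /rbin; apply: (canLR (mulfK (fact_neq0 R k))).
  rewrite -mulrA -natrM bin_ffact; elim: k => [|k IHk].
    by rewrite big_ord0 mul1r.
  rewrite big_ord_recr /= IHk exprSr ffactnSr natrM.
  have [nk|kn] := ltnP n k; first by rewrite ffact_small// !(mulr0, mul0r).
  have -> : - n.+1%:Z + k.+1%:Z = - (n - k)%N%:Z by lia.
  by rewrite rmorphN /= -[(_%:Z)%:~R]/((n - k)%N%:R : R[i]); ring.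
by rewrite rmorphM rmorphXn rmorphN1 rmorph_nat.
Qed.

Lemma cact_jetE s f g n : s 0%N = 0 -> cact f (jet s g) (1 - n.+1%:Z) =
  in_alg A (s n.+1) * (f * iter n.+2 D g) -
  \sum_(j < n.+1) (-1) ^+ j.+1 * 'C(n, j.+1)%:R * in_alg A (s (n.+1 - j)%N) *
     (iter j.+1 D f * iter (n.+1 - j) D g).
Proof.
move=> s0; rewrite cactE; pose t k := in_alg A (s k).
have GE : forall k, jet s g (1 - k%:Z) = t k * iter k D g := jetE s g.
have Dt : forall k, D (t k) = 0 by move=> k; exact: cderiv_in_alg.
have t0 : t 0%N = 0 by rewrite /t s0 rmorph0.
under eq_bigr do rewrite -/(t _); rewrite -/(t _).
have := @jet_vanishes s g; move: (coeff (jet s g)) GE => G GE G1.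
clearbody t.
rewrite (@rmulE _ 1 n.+3 _ _ _ G1); last by lia.
rewrite big_ord_recl rb0 mul1r big_ord_recr /= /bump leq0n add1n.
(* The last term, k = n + 2, carries s 0 = 0, and the term k = 0 cancels against the shifted part of
   [dleft]. *)
have -> : 1 - n.+1%:Z - 1 + n.+2%:Z = 1 - 0%:Z by lia.
rewrite (GE 0%N) t0 mul0r !mulr0 !addr0 /dleft mulrDr opprD addrACA subrr add0r.
rewrite GE cderivM Dt mul0r add0r; congr (_ - _); first by rewrite /=; ring.
apply: eq_bigr => j _; rewrite add1n add0n.
have -> : 1 - n.+1%:Z - 1 = - n.+1%:Z by lia.
have -> : - n.+1%:Z + j.+1%:Z = 1 - (n.+1 - j)%N%:Z by have := ltn_ord j; lia.
by rewrite GE rbN; ring.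
Qed.

(** The second hypothesis compares the coefficients of f^(j+1) g^(n+1-j) xi^(-n) in the cocycle
    identity; the extreme terms f g^(n+2) and f^(n+2) g agree by themselves. *)
Lemma jet_ccocycle s : s 0%N = 0 ->
  (forall n j, (j < n.+1)%N -> s n.+1 * ('C(n.+1, j.+1)%:R - 'C(n.+1, j)%:R) =
     (-1) ^+ j * 'C(n, j.+1)%:R * s (n.+1 - j)%N
     + (-1) ^+ (n.+1 - j) * 'C(n, n.+1 - j)%:R * s j.+1) ->
  ccocycle (jet s).
Proof.
move=> s0 sE; split=> [a f g||f g].
- apply/val_inj/funext => k; rewrite -[RHS]/(a *: jet_coeff s f k + jet_coeff s g k).
  rewrite /= /jet_coeff; case: ifP => _; last by rewrite scaler0 addr0.
  have -> : forall n, iter n D (a *: f + g) = a *: iter n D f + iter n D g.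
    by elim=> //= n ->; rewrite cderivD cderivZ.
  by rewrite scalerDr !scalerA mulrC.
- by exists 1 => f; exact: jet_vanishes.
apply/val_inj/funext => k.
rewrite -[RHS]/(cact f (jet s g) k - cact g (jet s f) k) -[LHS]/(jet s _ k).
have [k1|k1] := ltP 1 k.
  rewrite (jet_vanishes _ _ k1) !(@vanishes_cact _ 1 _ _ _ _ k1) ?subrr//; exact: jet_vanishes.
have -> : k = 1 - `|(1 - k)%R|%N%:Z by lia.
case: (`|(1 - k)%R|%N) => [|n].
  rewrite jetE s0 (rmorph0 (in_alg A)) mul0r.
  have top u v : cact u (jet s v) (1 - 0%:Z) = 0.
    rewrite (cact_top _ (@jet_vanishes s v)) (jetE s v 0) s0 (rmorph0 (in_alg A)).
    by rewrite mul0r /density_act raddf0 !mulr0 addr0.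
  by rewrite !top subrr.
rewrite !cact_jetE // jetE.
have -> : iter n.+1 D (f * D g - D f * g) =
   f * iter n.+2 D g - iter n.+2 D f * g +
   \sum_(j < n.+1) ('C(n.+1, j.+1)%:R - 'C(n.+1, j)%:R) * (iter j.+1 D f * iter (n.+1 - j) D g).
  have -> : forall i : nat, iter i D (f * D g - D f * g) = iter i D (f * D g) - iter i D (D f * g).
    by elim=> //= i ->; rewrite cderivD cderivN.
  rewrite !iter_cderivM big_ord_recl [X in _ - X]big_ord_recr.
  rewrite [X in _ + X - _](eq_bigr (fun j : 'I_n.+1 => 'C(n.+1, j.+1)%:R *
    (iter j.+1 D f * iter (n.+1 - j) D g))) => [|j _]; last first.
    by rewrite -[nat_of_ord (lift _ _)]/(j.+1) -iterSr -subSn ?ltn_ord.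
  rewrite [X in _ - (X + _)](eq_bigr (fun j : 'I_n.+1 => 'C(n.+1, j)%:R *
    (iter j.+1 D f * iter (n.+1 - j) D g))) => [|j _]; last by rewrite -iterSr.
  rewrite -[RHS]/(_ + \sum_(j < n.+1) _).
  under [in RHS]eq_bigr do rewrite mulrBl.
  rewrite sumrB.
  move: (\sum_(j < n.+1) _) (\sum_(j < n.+1) _) => S1 S2.
  by rewrite /= bin0 binn subnn -!iterSr /=; ring.
have -> : \sum_(j < n.+1) (-1) ^+ j.+1 * 'C(n, j.+1)%:R * in_alg A (s (n.+1 - j)%N) *
     (iter j.+1 D g * iter (n.+1 - j) D f) =
  \sum_(j < n.+1) (-1) ^+ (n.+1 - j) * 'C(n, n.+1 - j)%:R * in_alg A (s j.+1) *
     (iter j.+1 D f * iter (n.+1 - j) D g).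
  rewrite (reindex_inj rev_ord_inj); apply: eq_bigr => j _.
  rewrite -[nat_of_ord (rev_ord j)]/(n.+1 - j.+1)%N subSS -subSn ?leq_ord//.
  have -> : (n.+1 - (n - j))%N = j.+1 by have := ltn_ord j; lia.
  by rewrite [iter _ D g * _]mulrC.
have key : in_alg A (s n.+1) * \sum_(j < n.+1) ('C(n.+1, j.+1)%:R - 'C(n.+1, j)%:R) *
      (iter j.+1 D f * iter (n.+1 - j) D g) =
  \sum_(j < n.+1) (-1) ^+ (n.+1 - j) * 'C(n, n.+1 - j)%:R * in_alg A (s j.+1) *
     (iter j.+1 D f * iter (n.+1 - j) D g) -
  \sum_(j < n.+1) (-1) ^+ j.+1 * 'C(n, j.+1)%:R * in_alg A (s (n.+1 - j)%N) *
     (iter j.+1 D f * iter (n.+1 - j) D g).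
  rewrite mulr_sumr -sumrB; apply: eq_bigr => j _.
  have natE i : i%:R = in_alg A i%:R by rewrite rmorph_nat.
  have signE i : (-1) ^+ i = in_alg A ((-1) ^+ i) by rewrite rmorphXn rmorphN1.
  have e : in_alg A (s n.+1) * ('C(n.+1, j.+1)%:R - 'C(n.+1, j)%:R) =
     (-1) ^+ j * 'C(n, j.+1)%:R * in_alg A (s (n.+1 - j)%N)
     + (-1) ^+ (n.+1 - j) * 'C(n, n.+1 - j)%:R * in_alg A (s j.+1).
    by rewrite !natE !signE -rmorphB -!rmorphM -rmorphD sE.
  by rewrite mulrA e exprS; ring.
by rewrite mulrDr key; ring.
Qed.

End SymbolCocycles.

(** * The order filtration *)

Section Filtration.
Variable R : realType.
Local Notation A := (Csmooth R).
Local Notation D := (@cderiv R).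
Implicit Types (f g h u v : A) (P Q F : PsiD R) (z w : A -> PsiD R) (N m p : int) (n k : nat).
Implicit Types (a b c : R[i]).

Lemma ccocycle_ext z w : z =1 w -> ccocycle z -> ccocycle w.
Proof. by move=> /funext ->. Qed.

Lemma ccocycle0 : ccocycle (fun _ : A => 0 : PsiD R).
Proof.
split=> [a f g||f g]; first by rewrite scaler0 addr0.
  by exists 0.
by rewrite !cact0 subrr.
Qed.

Lemma ccocycleZ a z : ccocycle z -> ccocycle (fun f => a *: z f).
Proof.
by move=> zc; apply: ccocycle_ext (ccocycle_lin a zc ccocycle0) => f /=; rewrite addr0.
Qed.

Lemma ccocycleD z w : ccocycle z -> ccocycle w -> ccocycle (fun f => z f + w f).
Proof.
by move=> zc wc; apply: ccocycle_ext (ccocycle_lin 1 zc wc) => f /=; rewrite scale1r.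
Qed.

Lemma ccocycleB z w : ccocycle z -> ccocycle w -> ccocycle (fun f => z f - w f).
Proof.
move=> zc wc; apply: ccocycle_ext (ccocycle_lin (-1) wc zc) => f /=.
by rewrite scaleN1r addrC.
Qed.

(* theta_2 and theta_3 come from one family, since 2 (n - 3) / n = 2 - 6 / n and,
   at the index n - 1, 3 (n - 2) / n = 3 - 6 / n; the latter vanishes at n = 2.
   The weight of f' is a free parameter c. *)
Definition theta_seq a b c n : R[i] :=
  if n is m.+1 then if m is 0 then c else (-1) ^+ m * (a + b / m.+1%:R) else 0.

(** The source of this identity: for a = 0, b = c = 1 the jet is [log xi, f xi], a derivation
    applied to f xi. For a = c = 1, b = 0 it is xi^(-1) o f' o xi, the difference between f xi and
    its conjugate xi^(-1) o (f xi) o xi, and its values commute with one another. Both are therefore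
    cocycles, and so is f', which frees c. *)
Lemma theta_seq_rec a b c n j : (j < n.+1)%N ->
  theta_seq a b c n.+1 * ('C(n.+1, j.+1)%:R - 'C(n.+1, j)%:R) =
     (-1) ^+ j * 'C(n, j.+1)%:R * theta_seq a b c (n.+1 - j)%N
     + (-1) ^+ (n.+1 - j) * 'C(n, n.+1 - j)%:R * theta_seq a b c j.+1.
Proof.
have j0 i : i.+1%:R != 0 :> R[i] by rewrite pnatr_eq0.
have bin_next i r : 'C(i + r, i.+1)%:R = 'C(i + r, i)%:R * r%:R / i.+1%:R :> R[i].
  apply: (canRL (mulfK (j0 i))); rewrite -!natrM; congr (_%:R).
  by have := mul_bin_left (i + r) i; rewrite addKn; lia.
rewrite ltnS => jn; have [r nE] : exists r, n = (j + r)%N by exists (n - j)%N; rewrite subnKC.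
have -> : (n.+1 - j)%N = r.+1 by lia.
rewrite nE {n nE jn}.
have bsym : 'C(j + r, r)%:R = 'C(j + r, j)%:R :> R[i] by rewrite -bin_sub ?leq_addl// addnK.
have bE1 := bin_next j r; have bE2 := bin_next r j; rewrite addnC bsym in bE2.
have binE1 : 'C((j + r).+1, j.+1)%:R = 'C(j + r, j.+1)%:R + 'C(j + r, j)%:R :> R[i].
  by rewrite binS natrD.
have binE2 : 'C((j + r).+1, j)%:R = 'C(j + r, r.+1)%:R + 'C(j + r, j)%:R :> R[i].
  rewrite -bsym -natrD -binS -bin_sub; last by rewrite leqW// leq_addr.
  by congr ('C(_, _)%:R); lia.
rewrite binE1 binE2 bE1 bE2.
(* The exceptional entry c, at m = 0, is always multiplied by m; so the uniform formula may be used
   on the right-hand side. *)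
have thetaE (m : nat) : theta_seq a b c m.+1 * m%:R = (-1) ^+ m * (a + b / m.+1%:R) * m%:R.
  by case: m => [|m] //; rewrite !mulr0.
have [jr0|jr0] := eqVneq (j + r)%N 0%N.
  by have [-> ->] : j = 0%N /\ r = 0%N by [lia|]; rewrite !(mulr0, mul0r) subrr mulr0 addr0.
have -> : theta_seq a b c (j + r).+1 = (-1) ^+ (j + r) * (a + b / (j + r).+1%:R).
  by case: (j + r)%N jr0.
have := thetaE j; have := thetaE r.
move: (theta_seq _ _ _ _) (theta_seq _ _ _ _) => T3 T2 e3 e2.
move: ('C(_, _)%:R) => x.
have jr1 : (j + r).+1%:R = j%:R + r%:R + 1 :> R[i] by rewrite -natr1 natrD.
have := j0 j; have := j0 r; have := j0 (j + r)%N.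
rewrite jr1 -![_.+1%:R]natr1 in e2 e3 *.
rewrite exprS exprD; move: ((-1) ^+ j) ((-1) ^+ r) e2 e3 => s1 s2.
move: (j%:R) (r%:R) => J Q e2 e3 h1 h2 h3.
transitivity (s1 * (x / (J + 1)) * (T2 * Q) - s2 * (x / (Q + 1)) * (T3 * J)); last by field; rewrite h2 h3.
rewrite e2 e3; field; by rewrite h1 h2 h3.
Qed.

Definition ctheta0 f : PsiD R := monomial f 0.
Definition ctheta1 f := jet (theta_seq 0 0 1) f.
Definition ctheta2 f := jet (theta_seq 2 (-6) 0) f.
Definition ctheta3 f := jet (theta_seq 3 (-6) 0) f.

Lemma cact_ctheta0 f g m : cact f (ctheta0 g) m = monomial (f * D g) 0 m.
Proof.
have g0 : vanishes_above 0 (ctheta0 g) by move=> k k0 /=; rewrite gt_eqF.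
have [m0|m0] := ltP 0 m; first by rewrite (vanishes_cact f g0) //= gt_eqF.
rewrite cactE; have -> : m = - `|m|%N%:Z by lia.
move: (`|m|%N) => n.
rewrite (@rmulE _ 0 n.+2 _ _ _ g0) ?big1; first last.
- lia.
- move=> k _; have -> : - n%:Z - 1 = - n.+1%:Z by lia.
  (* Only k = n + 1 reaches the single nonzero coefficient, at index 0, and there the binomial C(n,
     n + 1) vanishes. *)
  have [->|kn] := eqVneq (k : nat) n.+1; first by rewrite rbN bin_small// mulr0 mul0r.
  have -> : coeff (ctheta0 g) (- n.+1%:Z + k%:Z) = 0; last by rewrite !mulr0.
  by rewrite /=; case: eqP => // k0; case/eqP: kn; lia.
rewrite /dleft /=; have -> : (- n%:Z - 1 == 0) = false by lia.
by case: eqP => _; rewrite ?add0r ?raddf0 ?mulr0 ?subr0 ?addr0.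
Qed.

Lemma ctheta0_ccocycle : ccocycle ctheta0.
Proof.
split=> [a f g||f g].
- by apply/val_inj/funext => k; rewrite -[RHS]/(a *: monomial f 0 k + monomial g 0 k) /=;
    case: ifP => // _; rewrite scaler0 addr0.
- by exists 0 => f k k0 /=; rewrite gt_eqF.
apply/val_inj/funext => m.
rewrite -[RHS]/(cact f (ctheta0 g) m - cact g (ctheta0 f) m) !cact_ctheta0 /=.
by case: ifP => _; rewrite ?subrr // [g * _]mulrC.
Qed.

Lemma theta_jet_ccocycle a b c : ccocycle (jet (theta_seq a b c)).
Proof. by apply: jet_ccocycle => // n j jn; exact: theta_seq_rec. Qed.

Definition theta_comb t0 t1 t2 t3 f : PsiD R :=
  t0 *: ctheta0 f + t1 *: ctheta1 f + t2 *: ctheta2 f + t3 *: ctheta3 f.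

Lemma comb_ccocycle t0 t1 t2 t3 : ccocycle (theta_comb t0 t1 t2 t3).
Proof.
rewrite /theta_comb; apply: ccocycleD; last exact: ccocycleZ (theta_jet_ccocycle _ _ _).
apply: ccocycleD; last exact: ccocycleZ (theta_jet_ccocycle _ _ _).
apply: ccocycleD; last exact: ccocycleZ (theta_jet_ccocycle _ _ _).
exact: ccocycleZ ctheta0_ccocycle.
Qed.

Lemma combE t0 t1 t2 t3 f (k : int) : theta_comb t0 t1 t2 t3 f k =
  t0 *: ctheta0 f k + t1 *: ctheta1 f k + t2 *: ctheta2 f k + t3 *: ctheta3 f k.
Proof. by []. Qed.

Lemma combD t0 t1 t2 t3 s0 s1 s2 s3 f :
  theta_comb (t0 + s0) (t1 + s1) (t2 + s2) (t3 + s3) f = theta_comb t0 t1 t2 t3 f + theta_comb s0 s1 s2 s3 f.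
Proof.
apply/val_inj/funext => k; rewrite -[RHS]/(theta_comb t0 t1 t2 t3 f k + theta_comb s0 s1 s2 s3 f k).
rewrite [LHS]combE !combE !scale_alg !(rmorphD (in_alg A)); ring.
Qed.

Lemma top_density z N : ccocycle z -> (forall f, vanishes_above N (z f)) ->
  density_cocycle (- N) (fun f => z f N).
Proof.
move=> [zL _ zC] zN; split=> [a f g|f g]; first by rewrite zL.
by rewrite zC -(cact_top _ (zN g)) -(cact_top _ (zN f)).
Qed.

Lemma theta_vanishes :
  [/\ forall f, vanishes_above 0 (ctheta0 f), forall f, vanishes_above 0 (ctheta1 f),
      forall f, vanishes_above (-1) (ctheta2 f) & forall f, vanishes_above (-2) (ctheta3 f)].
Proof.
have jet0 (s : nat -> R[i]) f (k : int) : (forall n, k = 1 - n%:Z -> s n = 0) -> jet s f k = 0.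
  move=> s0; have [k1|k1] := ltP 1 k; first exact: jet_vanishes.
  have kE : k = 1 - `|(1 - k)%R|%N%:Z by lia.
  by rewrite kE jetE s0 ?(rmorph0 (in_alg A)) ?mul0r.
split=> f k k0.
- by rewrite /= gt_eqF.
- by apply: jet0 => n kE; have -> : n = 0%N by lia.
- apply: jet0 => n kE; have : (n < 2)%N by lia.
  by case: n {kE} => [|[|]].
- apply: jet0 => n kE; have : (n < 3)%N by lia.
  (* The entry of index 2 is -(3 - 6/2) = 0, so the order drops from -1 to -2. *)
  case: n {kE} => [|[|[|]]] // _; rewrite /= expr1.
  by field.
Qed.

(** A lift of [density_class (- N) a b] to a symbol-valued cocycle of order N; it is zero outside
    the orders 0, -1 and -2. *)
Definition theta_top N a b f : PsiD R :=
  theta_comb (if N == 0 then a else 0) (if N == 0 then b else 0)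
    (if N == -1 then a else 0) (if N == -2 then a else 0) f.

Lemma theta_top_vanishes N a b f : vanishes_above N (theta_top N a b f).
Proof.
have [v0 v1 v2 v3] := theta_vanishes.
have sv (e : bool) M c P : (e -> M = N) -> vanishes_above M P ->
    vanishes_above N ((if e then c else 0) *: P).
  case: e => [/(_ isT) <-|_] P0 k Nk; last by rewrite -[LHS]/(0 *: P k) scale0r.
  by rewrite -[LHS]/(c *: P k) P0 ?scaler0.
have av P Q : vanishes_above N P -> vanishes_above N Q -> vanishes_above N (P + Q).
  by move=> P0 Q0 k Nk; rewrite -[LHS]/(P k + Q k) P0 ?Q0 ?addr0.
apply: (av); last by apply: (sv _ _ _ _ _ (v3 f)); move/eqP->.
apply: (av); last by apply: (sv _ _ _ _ _ (v2 f)); move/eqP->.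
apply: (av); last by apply: (sv _ _ _ _ _ (v1 f)); move/eqP->.
by apply: (sv _ _ _ _ _ (v0 f)); move/eqP->.
Qed.

Lemma ctheta1_top f : ctheta1 f 0 = D f.
Proof. by rewrite /ctheta1 (jetE _ f 1) rmorph1 mul1r. Qed.

Lemma ctheta2_top f : ctheta2 f (-1) = D (D f).
Proof.
rewrite /ctheta2 (jetE _ f 2) -[RHS]mul1r; congr (_ * _).
by rewrite -(rmorph1 (in_alg A)); congr (in_alg A _); rewrite /=; field.
Qed.

Lemma ctheta3_top f : ctheta3 f (-2) = D (D (D f)).
Proof.
rewrite /ctheta3 (jetE _ f 3) -[RHS]mul1r; congr (_ * _).
by rewrite -(rmorph1 (in_alg A)); congr (in_alg A _); rewrite /=; field.
Qed.

Lemma theta_topE N a b f : theta_top N a b f N = density_class (- N) a b f.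
Proof.
have [v0 v1 v2 v3] := theta_vanishes.
rewrite /theta_top combE /density_class oppr_eq0.
have -> : (- N == 1) = (N == -1) by rewrite eqr_oppLR.
have -> : (- N == 2) = (N == -2) by rewrite eqr_oppLR.
have [->|N0] := eqVneq N 0.
  by rewrite v2 // v3 // !scaler0 !addr0 ctheta1_top.
have [->|N1] := eqVneq N (-1).
  by rewrite v3 // !scaler0 !scale0r addr0 !add0r ctheta2_top.
have [->|N2] := eqVneq N (-2); last by rewrite !scale0r !addr0.
by rewrite !scale0r !add0r ctheta3_top.
Qed.

Lemma monomial_vanishes N h : vanishes_above N (monomial h N).
Proof. by move=> k Nk /=; rewrite gt_eqF. Qed.

Lemma lower_order z N : ccocycle z -> (forall f, vanishes_above N (z f)) ->
  exists h a b, forall f,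
    vanishes_above (N - 1) (z f - cact f (monomial h N) - theta_top N a b f).
Proof.
move=> zc zN; have [h [a [b zE]]] := density_H1 (top_density zc zN).
exists h, a, b => f k Nk.
rewrite -[LHS]/(z f k - cact f (monomial h N) k - theta_top N a b f k).
have [kN|->] : N < k \/ k = N by lia.
  rewrite zN // (vanishes_cact f (@monomial_vanishes N h)) // theta_top_vanishes //.
  by rewrite !subr0.
rewrite zE (cact_top f (@monomial_vanishes N h)) theta_topE /= eqxx.
by rewrite [density_act _ _ _ + _]addrC addrK subrr.
Qed.

Lemma reduce_to_order_m3 n z : ccocycle z -> (forall f, vanishes_above (n%:Z - 3) (z f)) ->
  exists F t0 t1 t2 t3, forall f,
    vanishes_above (-3) (z f - cact f F - theta_comb t0 t1 t2 t3 f).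
Proof.
elim: n z => [|n IHn] z zc zN.
  exists 0, 0, 0, 0, 0 => f; rewrite cact0 /theta_comb !scale0r !addr0 !subr0.
  exact: zN.
have [h [a [b wN]]] := lower_order zc zN; set N := n.+1%:Z - 3 in wN zN.
have wc : ccocycle (fun f => z f - cact f (monomial h N) - theta_top N a b f).
  by apply: ccocycleB (comb_ccocycle _ _ _ _); apply: ccocycleB zc (ccobound_ccocycle _).
have [|F [t0 [t1 [t2 [t3 FP]]]]] := IHn _ wc.
  move=> f; apply: vanishes_aboveW (wN f); rewrite /N; lia.
exists (monomial h N + F), ((if N == 0 then a else 0) + t0), ((if N == 0 then b else 0) + t1),
  ((if N == -1 then a else 0) + t2), ((if N == -2 then a else 0) + t3) => f.
rewrite cactD combD -/(theta_top N a b f).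
have regroup (V : zmodType) (a1 a2 a3 a4 a5 : V) :
    a1 - (a2 + a3) - (a4 + a5) = a1 - a2 - a4 - a3 - a5.
  by rewrite !opprD !addrA; congr (_ - _); rewrite addrAC.
by rewrite regroup; exact: FP.
Qed.

(* The density cohomology vanishes in weights >= 3, so each coefficient in turn is
   removed by some monomial; these monomials are the terms of F. *)
Lemma coboundary_below_m3 z : ccocycle z -> (forall f, vanishes_above (-3) (z f)) ->
  exists F, forall f, z f = cact f F.
Proof.
move=> zc zN.
pose good (q : (A -> PsiD R) * int) :=
  [/\ ccocycle q.1, q.2 <= -3 & forall f, vanishes_above q.2 (q.1 f)].
(* Choosing over all pairs, with default 0 off [good], makes H total, so that [zs] is a plain
   recursion and goodness can be proved afterwards. *)
have /choice[H HP] : forall q : (A -> PsiD R) * int, exists h, good q -> forall f,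
    vanishes_above (q.2 - 1) (q.1 f - cact f (monomial h q.2)).
  move=> [w N]; have [g|ng] := pselect (good (w, N)); last by exists 0 => /ng.
  have [wc N3 wN] := g; have [h [a [b hP]]] := lower_order wc wN.
  exists h => _ f; have := hP f; rewrite /theta_top /theta_comb.
  have -> : (N == 0) = false by apply/eqP; move: N3 => /= N3; lia.
  have -> : (N == -1) = false by apply/eqP; move: N3 => /= N3; lia.
  have -> : (N == -2) = false by apply/eqP; move: N3 => /= N3; lia.
  by rewrite !scale0r !addr0 subr0.
pose ord n : int := -3 - n%:Z.
pose zs := fix zs n : A -> PsiD R := if n is m.+1 then
  fun f => zs m f - cact f (monomial (H (zs m, ord m)) (ord m)) else z.
pose h n := H (zs n, ord n).
have zsS n f : zs n.+1 f = zs n f - cact f (monomial (h n) (ord n)) by [].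
have zs_good n : good (zs n, ord n).
  elim: n => [|n IHn]; first by split=> //= f; exact: zN.
  have [wc N3 wN] := IHn; split=> /=.
  - by apply: ccocycleB wc (ccobound_ccocycle _).
  - by rewrite /ord; lia.
  - by move=> f; apply: vanishes_aboveW (HP _ IHn f); rewrite /ord /=; lia.
pose Fs (i : int) : A := if i <= -3 then h `|(-3 - i)%R|%N else 0.
have FsP : Fs \in @bounded_order R.
  by apply/bounded_orderP; exists (-3) => k k3; rewrite /Fs leNgt k3.
pose F := MkPsiD FsP; exists F => f.
(* G is the truncation of F to the indices above [ord n], that is, the sum of the first n
   corrections. *)
have rest n : exists G : PsiD R, [/\ vanishes_above (ord n) (F - G)%R,
    forall k : int, k <= ord n -> G k = 0 & zs n f = z f - cact f G].
  elim: n => [|n [G [FG G0 zG]]].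
    exists 0; split=> //; last by rewrite cact0 subr0.
    by move=> k k3; rewrite -[LHS]/(Fs k - 0) subr0 /Fs leNgt; move: k3; rewrite /ord subr0 => ->.
  exists (G + monomial (h n) (ord n)); split; last first.
    rewrite zsS zG cactD.
    have regroup (V : zmodType) (a1 a2 a3 : V) : a1 - a2 - a3 = a1 - (a2 + a3).
      by rewrite opprD addrA.
    exact: regroup.
  - move=> k kn; rewrite -[LHS]/(G k + if k == ord n then h n else 0).
  have -> : (k == ord n) = false by move: kn; rewrite /ord; lia.
  by rewrite addr0 G0 //; move: kn; rewrite /ord; lia.
  move=> k kn; rewrite -[LHS]/(Fs k - (G k + if k == ord n then h n else 0)).
    have [->|kn'] := eqVneq k (ord n).
      rewrite G0 // add0r /Fs /ord.
      have -> : -3 - n%:Z <= -3 by lia.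
      have e : `|(-3 - (-3 - n%:Z))%R|%N = n by lia.
      by rewrite e subrr.
    by rewrite addr0; apply: FG; move: kn kn'; rewrite /ord; lia.
(* The coefficient of index k depends only on terms of F of index at least k. With [ord n] below k,
   F and its truncation act alike there, and the remainder [zs n] vanishes. *)
apply/val_inj/funext => k; pose n := `|(k + 3)%R|%N.+1.
have kn : ord n < k by rewrite /ord /n; lia.
have [G [FG _ zG]] := rest n; have [_ _ zs0] := zs_good n.
have : zs n f k = 0 := zs0 f k kn.
rewrite zG -[LHS]/(z f k - cact f G k) => /eqP; rewrite subr_eq0 => /eqP e1.
have := vanishes_cact f FG kn; rewrite cactB -[LHS]/(cact f F k - cact f G k).
by move=> /eqP; rewrite subr_eq0 => /eqP e2; exact: etrans e1 (esym e2).
Qed.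

End Filtration.

(** * Complexification *)

Section Complexification.
Variable R : realType.
Local Notation A := (Csmooth R).
Local Notation D := (@cderiv R).
Local Notation I := ('i%C : R[i]).
Implicit Types (f g h u v : A) (P Q F : PsiD R) (X Y : Vect R).

Fact vect_Re_subproof u : (fun x => complex.Re (u x)) \in @circle_smooth R.
Proof. by have /circle_csmoothP[] := valP u. Qed.

Fact vect_Im_subproof u : (fun x => complex.Im (u x)) \in @circle_smooth R.
Proof. by have /circle_csmoothP[] := valP u. Qed.

Definition vect_Re u : Vect R := MkVect (vect_Re_subproof u).
Definition vect_Im u : Vect R := MkVect (vect_Im_subproof u).

Lemma Csmooth_ReIm u : u = Vect_Csmooth (vect_Re u) + I *: Vect_Csmooth (vect_Im u).
Proof.
apply: Csmooth_eqP => x; rewrite -[RHS]/((complex.Re (u x))%:C%C + I * (complex.Im (u x))%:C%C).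
exact: complexE.
Qed.

Lemma cderiv_Vect X x : D (Vect_Csmooth X) x = (derive1 X x)%:C%C.
Proof.
apply/eqP; rewrite eq_complex; apply/andP; split=> //; apply/eqP.
exact: derive1_cst.
Qed.

Lemma Vect_Csmooth_bracket X Y : Vect_Csmooth (Vect_bracket X Y) =
  Vect_Csmooth X * D (Vect_Csmooth Y) - D (Vect_Csmooth X) * Vect_Csmooth Y.
Proof.
apply: Csmooth_eqP => x.
rewrite -[RHS]/(Vect_Csmooth X x * D (Vect_Csmooth Y) x - D (Vect_Csmooth X) x * Vect_Csmooth Y x).
rewrite !cderiv_Vect; apply/eqP; rewrite eq_complex /=.
by rewrite !mulr0 !mul0r !addr0 !subr0 !eqxx.
Qed.

Definition complexify (z : Vect R -> PsiD R) u : PsiD R :=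
  z (vect_Re u) + I *: z (vect_Im u).

Section RealLinear.
Variable z : Vect R -> PsiD R.
Hypothesis zL : forall (a : R) X Y, z (a *: X + Y) = (a%:C)%C *: z X + z Y.

Lemma real_lin0 : z 0 = 0.
Proof.
by have := zL (-1) 0 0; rewrite scaler0 addr0 (rmorphN1 (real_complex R)) scaleN1r addNr.
Qed.

Lemma complexify_lin a u v : complexify z (a *: u + v) = a *: complexify z u + complexify z v.
Proof.
have Re_lin : vect_Re (a *: u + v) =
    complex.Re a *: vect_Re u + (- complex.Im a *: vect_Im u + vect_Re v).
  apply/val_inj/funext => x.
  rewrite -[LHS]/(complex.Re (a * u x + v x)).
  rewrite -[RHS]/(complex.Re a * complex.Re (u x) + (- complex.Im a * complex.Im (u x) + complex.Re (v x))).
  by case: (a) (u x) (v x) => a1 a2 [b1 b2] [c1 c2] /=; rewrite addrA mulNr.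
have Im_lin : vect_Im (a *: u + v) =
    complex.Re a *: vect_Im u + (complex.Im a *: vect_Re u + vect_Im v).
  apply/val_inj/funext => x.
  rewrite -[LHS]/(complex.Im (a * u x + v x)).
  rewrite -[RHS]/(complex.Re a * complex.Im (u x) + (complex.Im a * complex.Re (u x) + complex.Im (v x))).
  by case: (a) (u x) (v x) => a1 a2 [b1 b2] [c1 c2] /=; rewrite addrA.
rewrite /complexify Re_lin Im_lin !zL.
apply/val_inj/funext => k.
move: (z (vect_Re u)) (z (vect_Im u)) (z (vect_Re v)) (z (vect_Im v)) => P Q P' Q'.
pose p := P k; pose q := Q k; pose p' := P' k; pose q' := Q' k.
rewrite -[LHS]/((complex.Re a)%:C%C *: p + ((- complex.Im a)%:C%C *: q + p') +
  I *: ((complex.Re a)%:C%C *: q + ((complex.Im a)%:C%C *: p + q'))).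
rewrite -[RHS]/(a *: (p + I *: q) + (p' + I *: q')).
rewrite [in RHS](complexE a).
have -> : (- complex.Im a)%:C%C = - (complex.Im a)%:C%C by apply/eqP; rewrite eq_complex /= oppr0 !eqxx.
move: (complex.Re a)%:C%C (complex.Im a)%:C%C => r s.
have ii := imagM R.
by rewrite !scale_alg; ring: ii.
Qed.

Lemma complexifyE X : complexify z (Vect_Csmooth X) = z X.
Proof.
have -> : complexify z (Vect_Csmooth X) = z X + I *: z 0.
  by congr (z _ + I *: z _); apply/val_inj/funext.
by rewrite real_lin0 scaler0 addr0.
Qed.

End RealLinear.

Lemma complexify_ccocycle z : z \in @cocycle1 R -> ccocycle (complexify z).
Proof.
move=> /asboolP[[zL [N zN] _] zC]; split=> [a f g||f g].
- exact: complexify_lin.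
- exists N => f k Nk; rewrite -[LHS]/(z (vect_Re f) k + I *: z (vect_Im f) k).
  by rewrite !zN// scaler0 addr0.
have brack X Y : complexify z (Vect_Csmooth X * D (Vect_Csmooth Y) - D (Vect_Csmooth X) * Vect_Csmooth Y)
   = cact (Vect_Csmooth X) (z Y) - cact (Vect_Csmooth Y) (z X).
  by rewrite -Vect_Csmooth_bracket complexifyE // zC.
have cD u v : complexify z (u + v) = complexify z u + complexify z v.
  by have := complexify_lin zL 1 u v; rewrite !scale1r.
have cZ a u : complexify z (a *: u) = a *: complexify z u.
  have c0 : complexify z 0 = 0.
    by have := complexify_lin zL (-1) 0 0; rewrite scaler0 addr0 scaleN1r addNr.
  by have := complexify_lin zL a u 0; rewrite c0 !addr0.
have actD u v P : cact (u + v) P = cact u P + cact v P.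
  by have := cact_linl P 1 u v; rewrite !scale1r.
have actZ a u P : cact (a *: u) P = a *: cact u P.
  have c0 : cact 0 P = 0.
    by have := cact_linl P (-1) 0 0; rewrite scaler0 addr0 scaleN1r addNr.
  by have := cact_linl P a u 0; rewrite c0 !addr0.
have actZr a u P : cact u (a *: P) = a *: cact u P.
  by have := cactZ u a P 0; rewrite cact0 !addr0.
pose f1 := Vect_Csmooth (vect_Re f); pose f2 := Vect_Csmooth (vect_Im f).
pose g1 := Vect_Csmooth (vect_Re g); pose g2 := Vect_Csmooth (vect_Im g).
have fE : f = f1 + I *: f2 := Csmooth_ReIm f.
have gE : g = g1 + I *: g2 := Csmooth_ReIm g.
have actf P : cact f P = cact f1 P + I *: cact f2 P by rewrite fE actD actZ.
have actg P : cact g P = cact g1 P + I *: cact g2 P by rewrite gE actD actZ.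
have -> : f * D g - D f * g =
   (f1 * D g1 - D f1 * g1) + (I *: (f1 * D g2 - D f1 * g2) +
   (I *: (f2 * D g1 - D f2 * g1) + (I * I) *: (f2 * D g2 - D f2 * g2))).
  by rewrite fE gE !cderivD !cderivZ !scale_alg rmorphM; ring.
have lin4 u1 u2 u3 u4 : complexify z (u1 + (I *: u2 + (I *: u3 + (I * I) *: u4))) =
    complexify z u1 + (I *: complexify z u2 + (I *: complexify z u3 + (I * I) *: complexify z u4)).
  by rewrite !cD !cZ.
rewrite lin4 !brack actf actg /complexify !cactD !actZr -/f1 -/f2 -/g1 -/g2.
move: (cact f1 _) (cact f1 _) (cact f2 _) (cact f2 _) (cact g1 _) (cact g1 _) (cact g2 _) (cact g2 _).
move=> p1 p2 p3 p4 p5 p6 p7 p8; apply/val_inj/funext => k.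
rewrite -[LHS]/(p2 k - p6 k + (I *: (p1 k - p8 k) + (I *: (p4 k - p5 k) + (I * I) *: (p3 k - p7 k)))).
rewrite -[RHS]/(p2 k + I *: p1 k + I *: (p4 k + I *: p3 k) - (p6 k + I *: p5 k + I *: (p8 k + I *: p7 k))).
by rewrite !scale_alg rmorphM; ring.
Qed.

End Complexification.

(** * Linear independence *)

Section Independence.
Variable R : realType.
Local Notation A := (Csmooth R).
Local Notation D := (@cderiv R).
Local Notation I := (in_alg A 'i%C).
Implicit Types (f g h u v : A) (P Q F : PsiD R) (N m p : int).

Lemma iter_cderiv1 (n : nat) : iter n.+1 D 1 = 0.
Proof. by elim: n => [|n IHn]; [exact: cderiv1|rewrite iterS IHn raddf0]. Qed.

Lemma cact_one F m : cact 1 F m = D (F m).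
Proof.
have /bounded_orderP[N F0] := valP F.
have nP : N - (m - 1) < `|(N - (m - 1))%R|%N.+1%:Z by lia.
rewrite cactE (rmulE _ F0 nP) big_ord_recl rb0 mul1r mul1r addr0 big1 ?addr0 => [|k _].
  by rewrite mul1r /dleft addrAC subrr add0r.
by rewrite [iter _ D 1](iter_cderiv1 k) mul0r mulr0.
Qed.

Lemma expi_scaleI n (a b : R[i]) :
  in_alg A a * expi R n = in_alg A b * expi R n -> a = b.
Proof.
move=> /(congr1 (fun u : A => (u * expi R (- n)) 0)).
by rewrite -!mulrA expi_mulN !mulr1 !algE.
Qed.

(** Testing on u = 1, which acts as d/dx, gives t0 = 0 and makes every coefficient of F constant. A
    constant a in order N then yields -N i n a on exp(inx), linear in n, which cannot match the
    quadratic and cubic eigenvalues of the leading terms f'' and f'''. *)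
Lemma comb_independent t0 t1 t2 t3 F : (forall u, theta_comb t0 t1 t2 t3 u = cact u F) ->
  [/\ t0 = 0, t1 = 0, t2 = 0 & t3 = 0].
Proof.
move=> tF; have [v0 v1 v2 v3] := theta_vanishes R.
have i0 : 'i%C != 0 :> R[i] by rewrite eq_complex /= oner_eq0 andbF.
have ii := sqr_i R.
have tFm u m : theta_comb t0 t1 t2 t3 u m = cact u F m by rewrite tF.
have t00 : t0 = 0.
  apply: (@exact_alg R); exists (F 0); have := tFm 1 0.
  rewrite cact_one combE ctheta1_top v2 // v3 // !scaler0 cderiv1 scaler0 !addr0.
  exact.
have dF m : D (F m) = 0.
  have [m0|m0] := eqVneq m 0.
    have := tFm 1 0; rewrite cact_one combE ctheta1_top v2 // v3 // !scaler0 cderiv1 scaler0 !addr0.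
    by rewrite t00 scale0r m0 => <-.
  have jet1 (s : nat -> R[i]) (k : int) : s 0%N = 0 -> jet s (1 : A) k = 0.
    move=> s0; have [k1|k1] := ltP 1 k; first exact: jet_vanishes.
    have -> : k = 1 - `|(1 - k)%R|%N%:Z by lia.
    rewrite jetE; case: (`|_|%N) => [|n]; first by rewrite s0 (rmorph0 (in_alg A)) mul0r.
    by rewrite iter_cderiv1 mulr0.
  have := tFm 1 m; rewrite cact_one combE t00 scale0r.
  by rewrite /ctheta1 /ctheta2 /ctheta3 !jet1 // !scaler0 !addr0 => <-.
have Fc m : exists a, F m = in_alg A a by have [a ->] := cderiv_eq0 (dF m); exists a.
have D1e n : D (expi R n) = in_alg A ('i%C * n%:~R) * expi R n.
  by rewrite cderiv_expi scale_alg.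
have D2e n : D (D (expi R n)) = in_alg A (('i%C * n%:~R) ^+ 2) * expi R n.
  by rewrite !(cderiv_expi, cderivZ) scalerA scale_alg -expr2.
have D3e n : D (D (D (expi R n))) = in_alg A (('i%C * n%:~R) ^+ 3) * expi R n.
  by rewrite !(cderiv_expi, cderivZ) !scalerA scale_alg; congr (in_alg A _ * _); ring.
have top G N n a : vanishes_above N (G : PsiD R) -> G N = in_alg A a ->
    cact (expi R n) G N = in_alg A (- N%:~R * 'i%C * n%:~R * a) * expi R n.
  move=> G0 GN; rewrite (cact_top _ G0) GN /density_act cderiv_in_alg mulr0 add0r.
  by rewrite D1e !rmorphM !rmorphN !rmorph_int; ring.
have F0 : vanishes_above 0 F.
  have /bounded_orderP[N FN] := valP F.
  have : vanishes_above `|N|%N%:Z F by apply: vanishes_aboveW FN; lia.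
  elim: (`|N|%N) => [|n IHn] // Fn; apply: IHn => k kn.
  have [->|kn'] := eqVneq k n.+1%:Z; last by apply: Fn; lia.
  have [a Fa] := Fc n.+1%:Z; rewrite Fa.
  have := tFm (expi R 1) n.+1%:Z; rewrite (top _ _ _ _ Fn Fa) combE v0 // v1 // v2 // v3 //.
  rewrite !scaler0 !addr0 -[X in X = _](mul0r (expi R 1)) -{1}(rmorph0 (in_alg A)) => /expi_scaleI/esym/eqP.
  rewrite !mulf_eq0 oppr_eq0 (negbTE i0) !intr_eq0 /= => /eqP ->.
  exact: (rmorph0 (in_alg A)).
have t10 : t1 = 0.
  have [a Fa] := Fc 0.
  have := tFm (expi R 1) 0; rewrite (top _ _ _ _ F0 Fa) combE ctheta1_top v2 // v3 //.
  rewrite t00 scale0r !scaler0 !addr0 add0r D1e oppr0 !mul0r scale_alg mulrA -rmorphM.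
  move=> /expi_scaleI/eqP; rewrite !mulf_eq0 (negbTE i0) oner_eq0 !orbF => /eqP //.
have [a0 Fa0] := Fc 0.
(* A constant of order 0 is invariant under the action, so removing it changes no coboundary and
   lowers the order to -1. *)
pose G := F - ctheta0 (F 0).
have tG u : theta_comb t0 t1 t2 t3 u = cact u G.
  rewrite tF /G cactB; suff -> : cact u (ctheta0 (F 0)) = 0 by rewrite subr0.
  apply/val_inj/funext => m; rewrite [LHS]cact_ctheta0 dF mulr0 /=.
  by case: ifP.
have tGm u m : theta_comb t0 t1 t2 t3 u m = cact u G m by rewrite tG.
have Gc m : exists a, G m = in_alg A a.
  rewrite -[G m]/(F m - if m == 0 then F 0 else 0).
  by case: ifP => _; [have [a ->] := Fc m; exists (a - a0); rewrite Fa0 rmorphB|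
    have [a ->] := Fc m; exists a; rewrite subr0].
have G1 : vanishes_above (-1) G.
  move=> k k1; rewrite -[LHS]/(F k - if k == 0 then F 0 else 0).
  have [->|k0] := eqVneq k 0; first by rewrite subrr.
  by rewrite F0 ?subrr//; lia.
have [a Ga] := Gc (-1).
(* Even against odd in n: the values n = 1 and n = -1 give t2 = 0 and then a = 0. *)
have e2 n : t2 * ('i%C * n%:~R) ^+ 2 = 'i%C * n%:~R * a.
  have := tGm (expi R n) (-1); rewrite (top _ _ _ _ G1 Ga) combE ctheta2_top v3 //.
  rewrite t00 t10 !scale0r !scaler0 !addr0 !add0r D2e scale_alg mulrA -rmorphM.
  by move=> /expi_scaleI ->; rewrite rmorphN1 opprK mul1r.
have e2p := e2 1; have e2n := e2 (-1).
rewrite rmorphN1 mulrN1 sqrrN mulNr in e2n; rewrite !mulr1 ii mulrN1 in e2p e2n.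
have t20 : t2 = 0.
  have : t2 + t2 = 0 by rewrite -[t2 in X in X + _]opprK e2p -[t2]opprK e2n opprK addNr.
  by move/eqP; rewrite -mulr2n mulrn_eq0 => /eqP.
have a00 : a = 0.
  by move/eqP: e2p; rewrite t20 oppr0 eq_sym mulf_eq0 (negbTE i0) => /eqP.
have G2 : vanishes_above (-2) G.
  move=> k k2; have [->|k1] := eqVneq k (-1); last by apply: G1; lia.
  by rewrite Ga a00 rmorph0.
have [b Gb] := Gc (-2).
(* Both sides are odd here, so the cubic and the linear growth are separated by n = 1 and n = 2. *)
have e3 n : t3 * ('i%C * n%:~R) ^+ 3 = 2 * 'i%C * n%:~R * b.
  have := tGm (expi R n) (-2); rewrite (top _ _ _ _ G2 Gb) combE ctheta3_top.
  rewrite t00 t10 t20 !scale0r !add0r D3e scale_alg mulrA -rmorphM.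
  by move=> /expi_scaleI ->; rewrite rmorphN opprK.
have e3p := e3 1; have e32 := e3 2.
have t30 : t3 = 0.
  have : 6 * ('i%C * t3) = 0.
    have e31 : - ('i%C * t3) = 2 * 'i%C * b by move: e3p; rewrite !mulr1 exprS ii => <-; ring.
    have : - 8 * ('i%C * t3) = 2 * (2 * 'i%C * b).
      have -> : 2 * (2 * 'i%C * b) = 2 * 'i%C * 2%:~R * b by ring.
      by rewrite -e32 exprMn exprS ii; ring.
    rewrite -e31 => e.
    have -> : 6 * ('i%C * t3) = 2 * - ('i%C * t3) - (- 8 * ('i%C * t3)) by ring.
    by rewrite e subrr.
  by move/eqP; rewrite !mulf_eq0 (negbTE i0) pnatr_eq0 => /eqP.
by [].
Qed.

End Independence.

(** * The cohomology classes *)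

Section ThetaClasses.
Variable R : realType.
Local Notation A := (Csmooth R).
Local Notation D := (@cderiv R).
Implicit Types (X Y : Vect R) (P F : PsiD R).

Lemma iter_cderiv_Vect X n t : iter n D (Vect_Csmooth X) t = (derive1n n X t)%:C%C.
Proof.
have re m : complex.Re (R:=R) \o iter m D (Vect_Csmooth X) = derive1n m X.
  elim: m => [|m IHm]; apply/funext => x //.
  by rewrite -[LHS]/(derive1 (complex.Re (R:=R) \o iter m D (Vect_Csmooth X)) x) IHm derive1nS.
have im m : complex.Im (R:=R) \o iter m D (Vect_Csmooth X) = cst 0.
  elim: m => [|m IHm]; apply/funext => x //.
  rewrite -[LHS]/(derive1 (complex.Im (R:=R) \o iter m D (Vect_Csmooth X)) x) IHm.
  exact: derive1_cst.
apply/eqP; rewrite eq_complex; apply/andP; split; apply/eqP.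
  by rewrite -[RHS]/(derive1n n X t) -re.
by have /(congr1 (fun h => h t)) := im n.
Qed.

Lemma nderiv_continuous n : continuous (nderiv n : Vect R -> A).
Proof.
apply/Csmooth_continuousP => m X e e0.
have [r r0 er] : exists2 r : R, 0 < r & e = r%:C%C.
  exists (complex.Re e); first by move: e0; rewrite ltcE => /andP[].
  by move: e0; rewrite ltcE => /andP[/eqP ei _]; apply/eqP; rewrite eq_complex /= ei !eqxx.
have /pointwise_cvgP/(_ (m + n)%N) : ({ptws, (@Vect_jet R) @ X --> Vect_jet X})%classic.
  exact: initial_continuous.
move=> /(_ _ [set h | forall t, `|Vect_jet X (m + n)%N t - h t| < r]%classic) near_jet.
have : \forall Y \near X, forall t, `|derive1n (m + n) (vcoef X) t - derive1n (m + n) (vcoef Y) t| < r.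
  apply: (near_jet (fmap_filter _ (nbhs_filter X))); apply/uniform_nbhs.
  exists [set p : R * R | `|p.1 - p.2| < r]%classic; split.
    by rewrite -entourage_ballE; exists r.
  by move=> h /= hP t; exact: hP.
apply: filterS => Y XY t.
rewrite /nderiv -!iterD !iter_cderiv_Vect er -(rmorphB (real_complex R)).
by rewrite normc_def /= expr0n addr0 sqrtr_sqr ltcR.
Qed.

Lemma restrict_cocycle1 (z : A -> PsiD R) (w : Vect R -> PsiD R) : ccocycle z ->
  (forall X, w X = z (Vect_Csmooth X)) ->
  (forall k, continuous (fun X => w X k : A)) -> w \in @cocycle1 R.
Proof.
move=> [zL [N zN] zC] wE wc; apply/asboolP; split; last first.
  by move=> X Y; rewrite !wE Vect_Csmooth_bracket zC.
split=> //.
- move=> a X Y; rewrite !wE -zL; congr z.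
  apply: Csmooth_eqP => x.
  rewrite -[LHS]/((a * X x + Y x)%:C%C) -[RHS]/(a%:C%C * (X x)%:C%C + (Y x)%:C%C).
  by rewrite !rmorphD rmorphM.
- by exists N => X; rewrite wE.
Qed.

Lemma continuous_scale_nderiv (a : R[i]) n : continuous (fun X : Vect R => a *: nderiv n X : A).
Proof.
have -> : (fun X : Vect R => a *: nderiv n X : A) = (fun X => a *: nderiv n X + 0).
  by apply/funext => X; rewrite addr0.
by apply: Csmooth_continuous_lin; [exact: nderiv_continuous|exact: cst_continuous].
Qed.

Lemma theta0_cocycle : @theta0 R \in @cocycle1 R.
Proof.
apply: restrict_cocycle1 (@ctheta0_ccocycle R) _ _ => // k.
have -> : (fun X => theta0 X k : A) = (fun X => (if k == 0 then 1 else 0) *: nderiv 0 X).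
  by apply/funext => X /=; case: ifP => _; rewrite ?scale1r ?scale0r.
exact: continuous_scale_nderiv.
Qed.

Lemma theta1_jet X : theta1 X = ctheta1 (Vect_Csmooth X).
Proof.
apply/val_inj/funext => k; rewrite -[LHS]/(if k == 0 then nderiv 1 X else 0).
rewrite -[RHS]/(jet_coeff _ _ k) /jet_coeff; have [k1|k1] := ltP 1 k.
  by have -> : (k == 0) = false by lia.
have -> : (k == 0) = (`|(1 - k)%R|%N == 1%N) by lia.
by case: (`|_|%N) => [|[|n]] /=; rewrite ?scale0r ?scale1r // mul0r addr0 mulr0 scale0r.
Qed.

Lemma theta2_jet X : theta2 X = ctheta2 (Vect_Csmooth X).
Proof.
apply/val_inj/funext => k; rewrite -[LHS]/(theta2_coeff X k) -[RHS]/(jet_coeff _ _ k).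
rewrite /theta2_coeff /jet_coeff; have [k1|k1] := ltP 1 k.
  by have -> : (k <= -1) = false by lia.
have -> : (k <= -1) = (1 < `|(1 - k)%R|)%N by lia.
case: (`|_|%N) => [|[|n]]; rewrite ?scale0r // -[theta_seq _ _ _ _]/((-1) ^+ n.+1 * _).
have : n.+2%:R != 0 :> R[i] by rewrite pnatr_eq0.
by rewrite subn1; move: (n.+2%:R) => x x0; congr (_ * _ *: _); field.
Qed.

Lemma theta3_jet X : theta3 X = ctheta3 (Vect_Csmooth X).
Proof.
apply/val_inj/funext => k; rewrite -[LHS]/(theta3_coeff X k) -[RHS]/(jet_coeff _ _ k).
rewrite /theta3_coeff /jet_coeff; have [k1|k1] := ltP 1 k.
  by have -> : (k <= -2) = false by lia.
have -> : (k <= -2) = (2 < `|(1 - k)%R|)%N by lia.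
have [k0|k0] := ltP 0 k.
  have -> : k = 1 by lia.
  by rewrite /= scale0r.
have -> : `|(1 - k)%R|%N = `|k|%N.+1 by lia.
case: (`|k|%N) => [|[|n]]; first by rewrite scale0r.
  (* k = -1 lies outside the range of [theta3], and the jet agrees because its entry of index 2 is
     zero. *)
  rewrite -[theta_seq _ _ _ _]/((-1) ^+ 1 * (3 + -6 / 2)).
  have -> : 3 + -6 / 2 = 0 :> R[i] by field.
  by rewrite mulr0 scale0r.
rewrite -[theta_seq _ _ _ _]/((-1) ^+ n.+2 * (3 + -6 / n.+3%:R)) natr1.
have : n.+3%:R != 0 :> R[i] by rewrite pnatr_eq0.
rewrite -[n.+2%:R](addrK 1) natr1; move: (n.+3%:R) => x x0.
by congr (_ * _ *: _); field.
Qed.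

Lemma jet_cocycle (a b c : R[i]) (w : Vect R -> PsiD R) :
  (forall X, w X = jet (theta_seq a b c) (Vect_Csmooth X)) -> w \in @cocycle1 R.
Proof.
move=> wE; apply: restrict_cocycle1 (theta_jet_ccocycle a b c) (wE) _ => k.
have -> : (fun X => w X k : A) = (fun X =>
    (if k <= 1 then theta_seq a b c `|(1 - k)%R|%N else 0) *: nderiv `|(1 - k)%R|%N X).
  by apply/funext => X; rewrite wE /= /jet_coeff; case: ifP => _; rewrite ?scale0r.
exact: continuous_scale_nderiv.
Qed.

Definition theta_tuple : 4.-tuple (Z1 R) :=
  [tuple MkZ1 theta0_cocycle; MkZ1 (jet_cocycle theta1_jet);
         MkZ1 (jet_cocycle theta2_jet); MkZ1 (jet_cocycle theta3_jet)].

Lemma H1_classD (z w : Z1 R) : H1_class (z + w) = H1_class z + H1_class w.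
Proof. exact: lmod_classD. Qed.

Lemma H1_classZ a (z : Z1 R) : H1_class (a *: z) = a *: H1_class z.
Proof. by rewrite /H1_class -lmod_class_scale. Qed.

Lemma H1_class_sum (c : 'I_4 -> R[i]) :
  \sum_(i < 4) c i *: H1_class (tnth theta_tuple i) =
  H1_class (\sum_(i < 4) c i *: tnth theta_tuple i).
Proof.
by rewrite !big_ord_recl !big_ord0 !addr0 -!H1_classZ -!H1_classD.
Qed.

Lemma theta_tuple_comb (c : 'I_4 -> R[i]) X :
  (\sum_(i < 4) c i *: tnth theta_tuple i : Z1 R) X =
  theta_comb (c 0) (c 1) (c 2%R) (c 3%R) (Vect_Csmooth X).
Proof.
rewrite !big_ord_recl big_ord0 addr0.
have -> : lift ord0 ord0 = 1 :> 'I_4 by apply: val_inj.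
have -> : lift ord0 (lift ord0 ord0) = 2%R :> 'I_4 by apply: val_inj.
have -> : lift ord0 (lift ord0 (lift ord0 ord0)) = 3%R :> 'I_4 by apply: val_inj.
rewrite -[LHS]/(c 0 *: theta0 X + (c 1 *: theta1 X + (c 2%R *: theta2 X + c 3%R *: theta3 X))).
by rewrite /theta_comb -theta1_jet -theta2_jet -theta3_jet !addrA.
Qed.

Lemma H1_class_eq0 (z : Z1 R) :
  H1_class z = 0 <-> exists F : PsiD R, forall X, z X = Vect_act X F.
Proof.
have -> : (0 : H1 R) = H1_class 0.
  by have := H1_classZ 0 0; rewrite !scale0r => ->.
rewrite /H1_class lmod_class_eq subr0; split=> [/asboolP //|zF].
exact/asboolP.
Qed.

Lemma theta_span (h : H1 R) : exists c : 'I_4 -> R[i],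
  h = \sum_(i < 4) c i *: H1_class (tnth theta_tuple i).
Proof.
pose z := repr h : Z1 R.
have hz : h = H1_class z by rewrite /H1_class lmod_class_repr.
have zc := complexify_ccocycle (valP z).
have [_ [N zN] _] := zc.
have [|F [t0 [t1 [t2 [t3 wN]]]]] := @reduce_to_order_m3 R `|(N + 3)%R|%N _ zc.
  by move=> f; apply: vanishes_aboveW (zN f); lia.
have wc := ccocycleB (ccocycleB zc (ccobound_ccocycle F)) (comb_ccocycle t0 t1 t2 t3).
have [G wG] := coboundary_below_m3 wc wN.
pose c (i : 'I_4) := [:: t0; t1; t2; t3]`_i.
exists c; apply/eqP; rewrite H1_class_sum hz -subr_eq0; apply/eqP.
rewrite -scaleN1r -H1_classZ -H1_classD scaleN1r; apply/H1_class_eq0.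
exists (F + G) => X.
have zL : forall (a : R) X Y, z (a *: X + Y) = (a%:C)%C *: z X + z Y.
  by have /asboolP[[]] := valP z.
rewrite -[LHS]/(z X - (\sum_(i < 4) c i *: tnth theta_tuple i : Z1 R) X) theta_tuple_comb.
rewrite -[RHS]/(cact (Vect_Csmooth X) (F + G)) cactD -wG complexifyE //.
have regroup (V : zmodType) (a b d : V) : a - b = d + (a - d - b).
  by rewrite addrA addrCA subrr addr0.
exact: regroup.
Qed.

Lemma theta_free (c : 'I_4 -> R[i]) :
  \sum_(i < 4) c i *: H1_class (tnth theta_tuple i) = 0 -> forall i, c i = 0.
Proof.
rewrite H1_class_sum => /H1_class_eq0[F cF].
have [|c0 c1 c2 c3] := @comb_independent R (c 0) (c 1) (c 2%R) (c 3%R) F.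
  have cE X : theta_comb (c 0) (c 1) (c 2%R) (c 3%R) (Vect_Csmooth X) = cact (Vect_Csmooth X) F.
    by rewrite -theta_tuple_comb cF.
  have [cL _ _] := comb_ccocycle (c 0) (c 1) (c 2%R) (c 3%R).
  (* Both sides are complex linear in u, so the identity on real fields extends to all complex
     ones. *)
  by move=> u; rewrite (Csmooth_ReIm u) addrC cL cact_linl !cE.
by case=> [[|[|[|[|]]]]] //= i4; [rewrite -c0|rewrite -c1|rewrite -c2|rewrite -c3];
  congr c; apply: val_inj.
Qed.

End ThetaClasses.

Theorem proposition6p2 (R : realType) :
  inhabited (Vector.axiom 4 (H1 R)) /\
  exists t : 4.-tuple (Z1 R),
    [seq cocycle_fun z | z <- t] =
      [:: @theta0 R; @theta1 R; @theta2 R; @theta3 R] /\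
    (forall h : H1 R, exists c : 'I_4 -> R[i],
       h = \sum_(i < 4) c i *: H1_class (tnth t i)).
Proof.
split; last by exists (theta_tuple R); split=> //; exact: theta_span.
pose r2v (r : 'rV[R[i]]_4) : H1 R := \sum_(i < 4) r 0 i *: H1_class (tnth (theta_tuple R) i).
have r2v_lin a r s : r2v (a *: r + s) = a *: r2v r + r2v s.
  rewrite /r2v scaler_sumr -big_split; apply: eq_bigr => i _ /=.
  by rewrite !mxE scalerDl scalerA.
have r2v_inj r s : r2v r = r2v s -> r = s.
  move=> e; apply/rowP => i; apply/eqP; rewrite -subr_eq0; apply/eqP.
  apply: (@theta_free R (fun i => r 0 i - s 0 i)).
  transitivity (r2v (-1 *: s + r)); last by rewrite r2v_lin e scaleN1r addNr.
  by apply: eq_bigr => j _; rewrite !mxE mulN1r addrC.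
(* Coordinates are chosen pointwise; their linearity follows from that of [r2v] by injectivity. *)
have /choice[v2r v2rK] : forall h, exists r, r2v r = h.
  move=> h; have [c ->] := theta_span h; exists (\row_i c i).
  by apply: eq_bigr => i _; rewrite mxE.
constructor; exists v2r.
  by move=> a g h; apply: r2v_inj; rewrite r2v_lin !v2rK.
by exists r2v; [exact: v2rK|move=> r; apply: r2v_inj; rewrite v2rK].
Qed.
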